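(* Let $\mathbf A_a$ be a finitely generated totally ordered pointed Abelian $\ell$-group and let $n$ be a nonzero integer. Then: (1) $\mathbf{HSP}(\mathbf A_a)=\mathbf{HSP}(\mathbf Z_0)=\mathbf{HSP}(\mathbf R_0)$ iff $a=0$; (2) $\mathbf{HSP}(\mathbf A_a)=\mathbf{HSP}(\mathbf Z_n)$ iff $\mathbf A_a$ is p-simple and $\mathrm{rank}(\mathbf A_a)=n$; (3) $\mathbf{HSP}(\mathbf A_a)=\mathbf{HSP}(\mathbf Z_n\ltimes\mathbf Z_0)$ iff $\mathbf A_a$ is not p-simple and $\mathrm{rank}(\mathbf A_a)=n$; (4) $\mathbf{HSP}(\mathbf A_a)=\mathbf{HSP}(\mathbf R_1)$ iff $\mathrm{rank}(\mathbf A_a)=\infty$; (5) $\mathbf{HSP}(\mathbf A_a)=\mathbf{HSP}(\mathbf R_{-1})$ iff $\mathrm{rank}(\mathbf A_a)=-\infty$.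
   Context: A pointed Abelian $\ell$-group $\mathbf A_a$ is an Abelian $\ell$-group $\mathbf A$ with a constant $\mathtt f$ interpreted as $a$. $\mathbf Z_n$ ($\mathbf R_r$) denotes the integers (reals) with usual order pointed at $n$ (at $r$). For a totally ordered $\mathbf A$ and an Abelian $\ell$-group $\mathbf B$, $\mathbf A\ltimes\mathbf B$ is the group $A\times B$ ordered lexicographically (first coordinate dominant; if first coordinates agree, lattice operations are computed in the second coordinate); $\mathbf A_a\ltimes\mathbf B_b$ is this product pointed at $\langle a,b\rangle$. For a totally ordered pointed Abelian $\ell$-group $\mathbf A_a$ with $a\ne 0$, its p-radical $\mathrm{p\text{-}rad}(\mathbf A_a)$ is the unique maximal convex $\ell$-subgroup of $\mathbf A$ not containing $a$; $\mathbf A_a$ is p-simple if $\mathrm{p\text{-}rad}(\mathbf A_a)=\{0\}$. A strong unit of $\mathbf B$ is $b$ with: for every $c\in B$ some $z\in\mathbb Z$ has $z\cdot b\ge c$. Let $\mathbf B_a$ be the smallest convex $\ell$-subgroup of $\mathbf A$ containing $a$ (so $a$ is a strong unit of it). Then $\mathrm{rank}(\mathbf A_a)$ is $0$ if $a=0$; $n$ if $\mathbf B_a/\mathrm{p\text{-}rad}(\mathbf B_a)\cong\mathbf Z_n$ as pointed $\ell$-groups; $\infty$ if $\mathbf B/\mathrm{p\text{-}rad}(\mathbf B_a)\not\cong\mathbf Z$ and $a>0$; $-\infty$ if $\mathbf B/\mathrm{p\text{-}rad}(\mathbf B_a)\not\cong\mathbf Z$ and $a<0$. $\mathbf{HSP}(\mathcal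 K)$ is the variety generated by $\mathcal K$.
   Formalization: Part (1) is stated only for nontrivial A: for the one-element ℓ-group a = 0, but HSP(A_a) is the trivial variety and not HSP(Z_0), so (1) fails there as written; parts (2)–(5) are unrestricted. *)

(* Defs.v *)
From HB Require Import structures.
From mathcomp Require Import all_boot all_order all_algebra.
From mathcomp Require Import boolp classical_sets reals constructive_ereal.

Set Implicit Arguments.
Unset Strict Implicit.
Unset Printing Implicit Defensive.

Import Order.Theory GRing.Theory Num.Theory.
Local Open Scope classical_set_scope.
Local Open Scope ring_scope.

(* A plain record rather than an HB structure: a join of [zmodType] and
   [latticeType ring_display] cannot be inserted above the already declared
   [realDomainType]. *)
Record lgroupType := LGroup {
  lgsort :> porderZmodType;
  lmeet : lgsort -> lgsort -> lgsort;
  ljoin : lgsort -> lgsort -> lgsort;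
  lmeetP : forall x y z : lgsort, (x <= lmeet y z) = (x <= y) && (x <= z);
  ljoinP : forall x y z : lgsort, (ljoin x y <= z) = (x <= z) && (y <= z);
  lgroup_leD2l : forall z x y : lgsort, x <= y -> z + x <= z + y
}.
Arguments LGroup : clear implicits.

Definition totally_ordered (L : lgroupType) : Prop := total (<=%R : rel L).

Record plgroup := PLGroup { plsort :> lgroupType; plpt : plsort }.
Arguments PLGroup : clear implicits.
Arguments plpt : clear implicits.

Definition lgroup_hom (L M : lgroupType) (f : L -> M) : Prop :=
  [/\ zmod_morphism f, {morph f : x y / lmeet x y >-> lmeet x y} &
      {morph f : x y / ljoin x y >-> ljoin x y}].

Definition lgroup_iso (L M : lgroupType) : Prop :=
  exists2 f : L -> M, lgroup_hom f & bijective f.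

Definition plgroup_hom (A B : plgroup) (f : A -> B) : Prop :=
  lgroup_hom f /\ f (plpt A) = plpt B.

Definition plgroup_iso (A B : plgroup) : Prop :=
  exists2 f : A -> B, plgroup_hom f & bijective f.

Section LGroupTheory.
Variable L : lgroupType.
Implicit Types x y z : L.

Lemma lmeet_lel x y : lmeet x y <= x.
Proof. by have := lexx (lmeet x y); rewrite lmeetP => /andP[]. Qed.

Lemma lmeet_ler x y : lmeet x y <= y.
Proof. by have := lexx (lmeet x y); rewrite lmeetP => /andP[]. Qed.

Lemma le_ljoinl x y : x <= ljoin x y.
Proof. by have := lexx (ljoin x y); rewrite ljoinP => /andP[]. Qed.

Lemma le_ljoinr x y : y <= ljoin x y.
Proof. by have := lexx (ljoin x y); rewrite ljoinP => /andP[]. Qed.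

Lemma lgroup_leD2r z x y : x <= y -> x + z <= y + z.
Proof. by rewrite ![_ + z]addrC; exact: lgroup_leD2l. Qed.

Lemma lgroup_leBlD z x y : x <= y + z -> x - z <= y.
Proof. by move=> /(lgroup_leD2r (- z)); rewrite addrK. Qed.

Lemma lgroup_le0B x y : x <= y -> 0 <= y - x.
Proof. by move=> /(lgroup_leD2r (- x)); rewrite subrr. Qed.

End LGroupTheory.

Section Subgroups.
Variable L : lgroupType.
Implicit Type S : set L.

Definition lsubgroup S : Prop :=
  [/\ S 0, forall x y, S x -> S y -> S (x - y),
      forall x y, S x -> S y -> S (lmeet x y) &
      forall x y, S x -> S y -> S (ljoin x y)].

Definition convex_lsubgroup S : Prop :=
  lsubgroup S /\ forall x y z, S x -> S y -> x <= z -> z <= y -> S z.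

Lemma convex_lsubgroup0 : convex_lsubgroup [set 0].
Proof.
split=> [|x y z /= -> -> z0 z1]; last by apply/le_anti; rewrite z0 z1.
split=> // x y /= -> ->; first by rewrite subr0.
- by apply/le_anti; rewrite lmeet_lel lmeetP lexx.
- by apply/le_anti; rewrite le_ljoinl ljoinP lexx.
Qed.

Lemma convex_lsubgroup_smallest S :
  convex_lsubgroup (smallest convex_lsubgroup S).
Proof.
split; first split.
- by move=> C [[[]]].
- move=> x y Sx Sy C [cC SC]; have [[_ CB _ _] _] := cC.
  by apply: CB; [apply: Sx|apply: Sy].
- move=> x y Sx Sy C [cC SC]; have [[_ _ CI _] _] := cC.
  by apply: CI; [apply: Sx|apply: Sy].
- move=> x y Sx Sy C [cC SC]; have [[_ _ _ CU] _] := cC.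
  by apply: CU; [apply: Sx|apply: Sy].
- move=> x y z Sx Sy xz zy C [cC SC]; have [_ Ccvx] := cC.
  by apply: (Ccvx x y z) => //; [apply: Sx|apply: Sy].
Qed.

End Subgroups.

Record convexLSubgroup (L : lgroupType) := ConvexLSubgroup {
  cvx_set : set L;
  cvx_setP : convex_lsubgroup cvx_set
}.
Arguments ConvexLSubgroup : clear implicits.

Section SubAndQuotient.
Variables (L : lgroupType) (C : convexLSubgroup L).

Definition cvx_pred : {pred L} := fun x => x \in cvx_set C.

Lemma cvx_predP (x : L) : reflect (cvx_set C x) (x \in cvx_pred).
Proof. by apply: (iffP idP) => [/set_mem|/mem_set]. Qed.

Fact cvx_zmod_closed : zmod_closed cvx_pred.
Proof.
have [[C0 CB _ _] _] := cvx_setP C.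
by split=> [|x y /cvx_predP Cx /cvx_predP Cy]; apply/cvx_predP => //; exact: CB.
Qed.

HB.instance Definition _ := GRing.isZmodClosed.Build L cvx_pred cvx_zmod_closed.

Definition cvx_sub_type : Type := {x : L | cvx_pred x}.

HB.instance Definition _ := SubChoice.on cvx_sub_type.
HB.instance Definition _ := [SubChoice_isSubZmodule of cvx_sub_type by <:].
HB.instance Definition _ :=
  [SubChoice_isSubPOrder of cvx_sub_type by <: with ring_display].

Fact sub_meet_subproof (x y : cvx_sub_type) : cvx_pred (lmeet (val x) (val y)).
Proof.
have [[_ _ CI _] _] := cvx_setP C.
by apply/cvx_predP; apply: CI; apply/cvx_predP; exact: valP.
Qed.

Fact sub_join_subproof (x y : cvx_sub_type) : cvx_pred (ljoin (val x) (val y)).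
Proof.
have [[_ _ _ CU] _] := cvx_setP C.
by apply/cvx_predP; apply: CU; apply/cvx_predP; exact: valP.
Qed.

Definition sub_meet (x y : cvx_sub_type) : cvx_sub_type :=
  Sub _ (sub_meet_subproof x y).

Definition sub_join (x y : cvx_sub_type) : cvx_sub_type :=
  Sub _ (sub_join_subproof x y).

Fact sub_meetP (x y z : cvx_sub_type) :
  (x <= sub_meet y z) = (x <= y) && (x <= z).
Proof. exact: lmeetP. Qed.

Fact sub_joinP (x y z : cvx_sub_type) :
  (sub_join x y <= z) = (x <= z) && (y <= z).
Proof. exact: ljoinP. Qed.

Fact sub_leD2l (z x y : cvx_sub_type) : x <= y -> z + x <= z + y.
Proof. exact: lgroup_leD2l. Qed.

Definition sub_lgroup : lgroupType :=
  LGroup cvx_sub_type sub_meet sub_join sub_meetP sub_joinP sub_leD2l.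

Definition cvx_quot_type : Type := Quotient.quot cvx_pred.

HB.instance Definition _ := GRing.Zmodule.on cvx_quot_type.

Definition quot_pi (x : L) : cvx_quot_type := (\pi_(Quotient.quot cvx_pred) x)%qT.
Definition quot_repr (X : cvx_quot_type) : L := repr (X : Quotient.quot cvx_pred).

Lemma quot_reprK : cancel quot_repr quot_pi.
Proof. by move=> X; rewrite /quot_pi /quot_repr reprK. Qed.

Lemma quot_piP (x y : L) : quot_pi x = quot_pi y <-> cvx_set C (x - y).
Proof.
split=> [/eqP|Cxy].
  by rewrite /quot_pi -Quotient.idealrBE => /cvx_predP.
by apply/eqP; rewrite /quot_pi -Quotient.idealrBE; apply/cvx_predP.
Qed.

Lemma quot_piB : zmod_morphism quot_pi.
Proof. by move=> x y; rewrite /quot_pi raddfB. Qed.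

Definition quot_le (X Y : cvx_quot_type) : bool :=
  `[< exists x y, [/\ quot_pi x = X, quot_pi y = Y & x <= y] >].

Lemma quot_leP (x y : L) :
  quot_le (quot_pi x) (quot_pi y) <-> exists2 p, cvx_set C p & x <= y + p.
Proof.
have [[C0 CB _ _] _] := cvx_setP C.
split=> [/asboolP[u [v [/quot_piP ux /quot_piP vy uv]]]|[p Cp xyp]].
  exists ((v - y) - (u - x)); first exact: CB.
  have -> : y + (v - y - (u - x)) = v + (x - u).
    by rewrite opprB addrA [y + _]addrC subrK.
  by have := lgroup_leD2r (x - u) uv; rewrite addrC subrK.
apply/asboolP; exists x, (y + p); split=> //.
by apply/quot_piP; rewrite addrAC subrr add0r.
Qed.

Lemma cvxD (x y : L) :
  cvx_set C x -> cvx_set C y -> cvx_set C (x + y).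
Proof.
have [[C0 CB _ _] _] := cvx_setP C => Cx Cy.
by rewrite -[y]opprK -[- y]sub0r; apply: (CB) => //; apply: CB.
Qed.

Fact quot_le_refl : reflexive quot_le.
Proof.
by move=> X; apply/asboolP; exists (quot_repr X), (quot_repr X);
  rewrite quot_reprK.
Qed.

Fact quot_le_anti : antisymmetric quot_le.
Proof.
have [[C0 CB _ _] Ccvx] := cvx_setP C.
move=> X Y; rewrite -(quot_reprK X) -(quot_reprK Y).
move: (quot_repr X) (quot_repr Y) => x y.
move=> /andP[/quot_leP[p Cp xy] /quot_leP[q Cq yx]]; apply/quot_piP.
have Cq' : cvx_set C (- q) by rewrite -sub0r; exact: CB.
apply: (Ccvx (- q) p) => //.
  by have := lgroup_leD2r (- q - y) yx; rewrite addrCA subrr addr0 [- q - y]addrC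
    addrA [x + q - y]addrAC addrK.
by apply: lgroup_leBlD; rewrite addrC.
Qed.

Fact quot_le_trans : transitive quot_le.
Proof.
move=> Y X Z; rewrite -(quot_reprK X) -(quot_reprK Y) -(quot_reprK Z).
move: (quot_repr X) (quot_repr Y) (quot_repr Z) => x y z.
move=> /quot_leP[p Cp xy] /quot_leP[q Cq yz]; apply/quot_leP.
exists (q + p); first exact: cvxD.
by apply: (le_trans xy); rewrite addrA; exact: lgroup_leD2r.
Qed.

HB.instance Definition _ :=
  Order.Le_isPOrder.Build ring_display cvx_quot_type
    quot_le_refl quot_le_anti quot_le_trans.

Definition quot_meet (X Y : cvx_quot_type) : cvx_quot_type :=
  quot_pi (lmeet (quot_repr X) (quot_repr Y)).

Definition quot_join (X Y : cvx_quot_type) : cvx_quot_type :=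
  quot_pi (ljoin (quot_repr X) (quot_repr Y)).

Lemma quot_pi_le (x y : L) : x <= y -> quot_pi x <= quot_pi y.
Proof. by move=> xy; apply/asboolP; exists x, y. Qed.

Fact quot_meetP (X Y Z : cvx_quot_type) :
  (X <= quot_meet Y Z) = (X <= Y) && (X <= Z).
Proof.
have [[C0 CB CI CU] Ccvx] := cvx_setP C.
apply/idP/andP => [XYZ|[]].
  split; apply: (le_trans XYZ).
    by rewrite -[leRHS]quot_reprK; apply/quot_pi_le/lmeet_lel.
  by rewrite -[leRHS]quot_reprK; apply/quot_pi_le/lmeet_ler.
rewrite /quot_meet -{1 2 3}(quot_reprK X) -{1}(quot_reprK Y) -{1}(quot_reprK Z).
move: (quot_repr X) (quot_repr Y) (quot_repr Z) => x y z.
move=> /quot_leP[p Cp xy] /quot_leP[q Cq xz]; apply/quot_leP.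
exists (ljoin p q); first exact: CU.
have := @lgroup_leD2r L (ljoin p q) (x - ljoin p q) (lmeet y z).
rewrite subrK; apply; rewrite lmeetP; apply/andP; split; apply: lgroup_leBlD.
  by apply: (le_trans xy); apply/lgroup_leD2l/le_ljoinl.
by apply: (le_trans xz); apply/lgroup_leD2l/le_ljoinr.
Qed.

Fact quot_joinP (X Y Z : cvx_quot_type) :
  (quot_join X Y <= Z) = (X <= Z) && (Y <= Z).
Proof.
have [[C0 CB CI CU] Ccvx] := cvx_setP C.
apply/idP/andP => [XYZ|[]].
  split; apply: (le_trans _ XYZ).
    by rewrite -[leLHS]quot_reprK; apply/quot_pi_le/le_ljoinl.
  by rewrite -[leLHS]quot_reprK; apply/quot_pi_le/le_ljoinr.
rewrite /quot_join -{1}(quot_reprK X) -{1}(quot_reprK Y) -{1 2 3}(quot_reprK Z).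
move: (quot_repr X) (quot_repr Y) (quot_repr Z) => x y z.
move=> /quot_leP[p Cp xz] /quot_leP[q Cq yz]; apply/quot_leP.
exists (ljoin p q); first exact: CU.
rewrite ljoinP; apply/andP; split.
  by apply: (le_trans xz); apply/lgroup_leD2l/le_ljoinl.
by apply: (le_trans yz); apply/lgroup_leD2l/le_ljoinr.
Qed.

Fact quot_leD2l (Z X Y : cvx_quot_type) : X <= Y -> Z + X <= Z + Y.
Proof.
rewrite -(quot_reprK X) -(quot_reprK Y) -(quot_reprK Z).
move: (quot_repr X) (quot_repr Y) (quot_repr Z) => x y z.
have piD u v : quot_pi u + quot_pi v = quot_pi (u + v).
  by rewrite /quot_pi raddfD.
rewrite !piD => /quot_leP[p Cp xy]; apply/quot_leP; exists p => //.
by rewrite -addrA; exact: lgroup_leD2l.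
Qed.

Definition quot_lgroup : lgroupType :=
  LGroup cvx_quot_type quot_meet quot_join quot_meetP quot_joinP quot_leD2l.

End SubAndQuotient.

Section LexicographicProduct.
Variables (L : lgroupType) (L_total : totally_ordered L) (M : lgroupType).

Definition lex_type : Type := (L * M)%type.

HB.instance Definition _ := GRing.Zmodule.copy lex_type (L * M)%type.
HB.instance Definition _ :=
  Order.POrder.copy lex_type (L *lexi[ring_display] M).

Lemma lex_leE (x y : lex_type) :
  (x <= y) = (x.1 < y.1) || (x.1 == y.1) && (x.2 <= y.2).
Proof.
have -> : (x <= y) = (x.1 <= y.1) && ((y.1 <= x.1) ==> (x.2 <= y.2)) by [].
by case: comparableP.
Qed.

Definition lex_meet (x y : lex_type) : lex_type :=
  if x.1 < y.1 then x else if y.1 < x.1 then y else (x.1, lmeet x.2 y.2).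

Definition lex_join (x y : lex_type) : lex_type :=
  if x.1 < y.1 then y else if y.1 < x.1 then x else (x.1, ljoin x.2 y.2).

Variant lex_cmp (a b : L) : bool -> bool -> bool -> Prop :=
  | LexLt of a < b : lex_cmp a b true false false
  | LexGt of b < a : lex_cmp a b false true false
  | LexEq of a = b : lex_cmp a b false false true.

Fact lex_cmpP (a b : L) : lex_cmp a b (a < b) (b < a) (a == b).
Proof.
have := L_total a b; case: (comparableP a b) => //= h _; by constructor.
Qed.

Fact lex_meetP (x y z : lex_type) :
  (x <= lex_meet y z) = (x <= y) && (x <= z).
Proof.
case: x y z => [x x'] [y y'] [z z']; rewrite /lex_meet /=.
case: (lex_cmpP y z) => [yz|zy|<-]; rewrite !lex_leE /=.
- apply/idP/andP => [xy|[]//]; split=> //.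
  by case/orP: xy => [/lt_trans ->//|/andP[/eqP -> _]]; rewrite yz.
- apply/idP/andP => [xz|[]//]; split=> //.
  by case/orP: xz => [/lt_trans ->//|/andP[/eqP -> _]]; rewrite zy.
- by rewrite lmeetP; case: (x < y) => //=; case: (x == y).
Qed.

Fact lex_joinP (x y z : lex_type) :
  (lex_join x y <= z) = (x <= z) && (y <= z).
Proof.
case: x y z => [x x'] [y y'] [z z']; rewrite /lex_join /=.
case: (lex_cmpP x y) => [xy|yx|<-]; rewrite !lex_leE /=.
- apply/idP/andP => [yz|[]//]; split=> //.
  by case/orP: yz => [/(lt_trans xy) ->//|/andP[/eqP <- _]]; rewrite xy.
- apply/idP/andP => [xz|[]//]; split=> //.
  by case/orP: xz => [/(lt_trans yx) ->//|/andP[/eqP <- _]]; rewrite yx.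
- by rewrite ljoinP; case: (x < z) => //=; case: (x == z).
Qed.

Fact lex_leD2l (z x y : lex_type) : x <= y -> z + x <= z + y.
Proof.
case: x y z => [x x'] [y y'] [z z']; rewrite !lex_leE /=.
case/orP => [xy|/andP[/eqP -> xy]].
  by rewrite lt_def (lgroup_leD2l z (ltW xy)) (inj_eq (addrI z)) (gt_eqF xy).
by rewrite eqxx (lgroup_leD2l z' xy) orbT.
Qed.

Definition lex_lgroup : lgroupType :=
  LGroup lex_type lex_meet lex_join lex_meetP lex_joinP lex_leD2l.

End LexicographicProduct.

Definition plex (A : plgroup) (A_total : totally_ordered A) (B : plgroup) :
  plgroup := PLGroup (lex_lgroup A_total B) (plpt A, plpt B).

Section Product.
Variables (I : Type) (F : I -> lgroupType).

Definition prod_type : Type := forall i, F i.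

HB.instance Definition _ := Choice.copy prod_type (forall i, F i).

Definition prod_zero : prod_type := fun=> 0.
Definition prod_opp (f : prod_type) : prod_type := fun i => - f i.
Definition prod_add (f g : prod_type) : prod_type := fun i => f i + g i.

Fact prod_addA : associative prod_add.
Proof.
by move=> f g h; apply: functional_extensionality_dep => i; exact: addrA.
Qed.
Fact prod_addC : commutative prod_add.
Proof.
by move=> f g; apply: functional_extensionality_dep => i; exact: addrC.
Qed.
Fact prod_add0 : left_id prod_zero prod_add.
Proof.
by move=> f; apply: functional_extensionality_dep => i; exact: add0r.
Qed.
Fact prod_addN : left_inverse prod_zero prod_opp prod_add.
Proof.
by move=> f; apply: functional_extensionality_dep => i; exact: addNr.
Qed.

HB.instance Definition _ :=
  GRing.isZmodule.Build prod_type prod_addA prod_addC prod_add0 prod_addN.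

Definition prod_le (f g : prod_type) : bool := `[< forall i, f i <= g i >].

Fact prod_le_refl : reflexive prod_le.
Proof. by move=> f; apply/asboolP => i. Qed.
Fact prod_le_anti : antisymmetric prod_le.
Proof.
move=> f g /andP[/asboolP fg /asboolP gf].
by apply: functional_extensionality_dep => i; apply/le_anti; rewrite fg gf.
Qed.
Fact prod_le_trans : transitive prod_le.
Proof.
move=> g f h /asboolP fg /asboolP gh.
by apply/asboolP => i; exact: le_trans (gh i).
Qed.

HB.instance Definition _ :=
  Order.Le_isPOrder.Build ring_display prod_type
    prod_le_refl prod_le_anti prod_le_trans.

Definition prod_meet (f g : prod_type) : prod_type := fun i => lmeet (f i) (g i).
Definition prod_join (f g : prod_type) : prod_type := fun i => ljoin (f i) (g i).

Fact prod_meetP (f g h : prod_type) :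
  (f <= prod_meet g h) = (f <= g) && (f <= h).
Proof.
apply/asboolP/andP => [fgh|[/asboolP fg /asboolP fh] i].
  by split; apply/asboolP => i; have := fgh i; rewrite lmeetP => /andP[].
by rewrite lmeetP fg fh.
Qed.

Fact prod_joinP (f g h : prod_type) :
  (prod_join f g <= h) = (f <= h) && (g <= h).
Proof.
apply/asboolP/andP => [fgh|[/asboolP fh /asboolP gh] i].
  by split; apply/asboolP => i; have := fgh i; rewrite ljoinP => /andP[].
by rewrite ljoinP fh gh.
Qed.

Fact prod_leD2l (h f g : prod_type) : f <= g -> h + f <= h + g.
Proof. by move=> /asboolP fg; apply/asboolP => i; exact: lgroup_leD2l. Qed.

Definition prod_lgroup : lgroupType :=
  LGroup prod_type prod_meet prod_join prod_meetP prod_joinP prod_leD2l.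

End Product.

Definition plprod (I : Type) (F : I -> plgroup) : plgroup :=
  PLGroup (prod_lgroup (fun i => F i)) (fun i => plpt (F i)).

(* [set plgroup] would be a universe inconsistency. *)
Definition plclass := plgroup -> Prop.

Definition same_class (K1 K2 : plclass) : Prop := forall B, K1 B <-> K2 B.

(* Each class operator yields a class closed under isomorphism. *)
Definition classP (K : plclass) : plclass := fun B =>
  exists (I : Type) (F : I -> plgroup),
    (forall i, K (F i)) /\ plgroup_iso B (plprod F).

Definition classS (K : plclass) : plclass := fun B =>
  exists (C : plgroup) (f : B -> C), [/\ K C, plgroup_hom f & injective f].

Definition classH (K : plclass) : plclass := fun B =>
  exists (C : plgroup) (f : C -> B),
    [/\ K C, plgroup_hom f & forall y, exists x, f x = y].

Definition HSP (K : plclass) : plclass := classH (classS (classP K)).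

Definition HSP1 (A : plgroup) : plclass := HSP (fun B => B = A).

Section RealDomain.
Variable R : realDomainType.

Fact rdom_meetP (x y z : R) : (x <= Num.min y z) = (x <= y) && (x <= z).
Proof. exact: le_min. Qed.
Fact rdom_joinP (x y z : R) : (Num.max x y <= z) = (x <= z) && (y <= z).
Proof. exact: ge_max. Qed.
Fact rdom_leD2l (z x y : R) : x <= y -> z + x <= z + y.
Proof. by rewrite lerD2l. Qed.

Definition rdom_lgroup : lgroupType :=
  LGroup R Num.min Num.max rdom_meetP rdom_joinP rdom_leD2l.

Lemma rdom_total : totally_ordered rdom_lgroup.
Proof. exact: le_total. Qed.

End RealDomain.

Definition Zpt (n : int) : plgroup := PLGroup (rdom_lgroup int) n.

Definition Rpt (R : realType) (r : R) : plgroup := PLGroup (rdom_lgroup R) r.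
Arguments Rpt : clear implicits.

Definition Zlex (n : int) : plgroup :=
  @plex (Zpt n) (@rdom_total int) (Zpt 0).

Section FinitelyGenerated.
Variable A : plgroup.

Definition plsubgroup (S : set A) : Prop := lsubgroup S /\ S (plpt A).

Definition finitely_generated : Prop :=
  exists s : seq A, smallest plsubgroup [set` s] = setT.

End FinitelyGenerated.

Section RadicalAndRank.
Variable A : plgroup.

Definition is_pradical (P : set A) : Prop :=
  [/\ convex_lsubgroup P, ~ P (plpt A) &
      forall Q : set A,
        convex_lsubgroup Q -> ~ Q (plpt A) -> P `<=` Q -> Q = P].

(* Meaningful when A is totally ordered and pointed at a nonzero element; no
   convex l-subgroup avoids the point 0, and the default {0} is then junk. *)
Definition pradical : set A := xget [set 0] [set P | is_pradical P].

Lemma pradical_convex : convex_lsubgroup pradical.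
Proof.
by rewrite /pradical; case: xgetP => [P _ []|_] //; exact: convex_lsubgroup0.
Qed.

Definition p_simple : Prop := plpt A != 0 /\ pradical = [set 0].

Definition pradical_quot : plgroup :=
  let C := ConvexLSubgroup A pradical pradical_convex in
  PLGroup (quot_lgroup C) (quot_pi C (plpt A)).

Definition point_hull : convexLSubgroup A :=
  ConvexLSubgroup A _ (convex_lsubgroup_smallest [set plpt A]).

Fact point_in_hull : cvx_pred point_hull (plpt A).
Proof. by apply/mem_set; exact: sub_gen_smallest. Qed.

(* The pointed l-group written B_a in the definition of the rank. *)
Definition point_hull_plgroup : plgroup :=
  PLGroup (sub_lgroup point_hull) (Sub (plpt A) point_in_hull).

End RadicalAndRank.

Definition rank (A : plgroup) : \bar int :=
  let Q := pradical_quot (point_hull_plgroup A) in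
  if plpt A == 0 then 0%:E
  else if `[< lgroup_iso Q (rdom_lgroup int) >] then
    (xget 0 [set n : int | plgroup_iso Q (Zpt n)])%:E
  else if 0 < plpt A then +oo%E else -oo%E.

(* Main.v *)
From HB Require Import structures.
Require Import Defs.
From mathcomp Require Import all_boot all_order all_algebra.
From mathcomp Require Import boolp classical_sets reals constructive_ereal.
From mathcomp Require Import zify ring lra.

Set Implicit Arguments.
Unset Strict Implicit.
Unset Printing Implicit Defensive.

Import Order.Theory GRing.Theory Num.Theory.
Local Open Scope classical_set_scope.
Local Open Scope ring_scope.

(* By the free-algebra argument, inclusion of varieties is inclusion of sets of
   valid inequalities [0 <= t]. A failure of [0 <= t] in an o-group is witnessed
   by finitely many linear inequalities, so it moves to any algebra in which
   those can be solved: Fourier-Motzkin elimination gives rational, hence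
   integer, solutions, and when the rank is [n] a basis modulo the convex hull
   of the point, together with a generator [c] of the hull modulo
   infinitesimals, gives solutions in [Zlex n], or in [Zpt n] if there are no
   infinitesimals. Conversely, failures in the model algebras are robust:
   values of terms are Lipschitz in their arguments, which makes up for the
   point being only infinitesimally close to [n c], or, if the rank is infinite,
   only approximately a large multiple of some [e > 0]. Thus every pointed
   o-group with nonzero point has the theory of exactly one of the models, and
   the models are told apart by the sign of the point and two families of
   identities. *)

(** * Linear constraints *)

(** The difficulty is that a solution must hit the point exactly, while elimination solves
    homogeneous systems and controls no single value. This is harmless if the point is 0, and in the
    reals one can divide by its value. For finite rank [n] each variable is split into three scales:
    a part outside the hull of the point, an integer multiple of [c], and an infinitesimal. The
    middle coefficients are kept unchanged, so that the point keeps its value [n]; only the two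
    outer scales are replaced by solutions found by elimination. A large factor lets the outermost
    scale share one integer coordinate with the middle one. The point may still have a nonzero
    infinitesimal part, which a shear of the second coordinate along the first removes. *)

Definition dot (A : zmodType) (K : nat) (x : nat -> A) (g : nat -> int) : A :=
  \sum_(i < K) x i *~ g i.

Lemma dotS (A : zmodType) K (x : nat -> A) g :
  dot K.+1 x g = dot K x g + x K *~ g K.
Proof. exact: big_ord_recr. Qed.

Lemma eq_dot (A : zmodType) K (x y : nat -> A) g h :
  (forall i, (i < K)%N -> x i = y i) -> (forall i, (i < K)%N -> g i = h i) ->
  dot K x g = dot K y h.
Proof. by move=> xy gh; apply: eq_bigr => i _; rewrite xy // gh. Qed.

Lemma dot_comb (A : zmodType) K (x : nat -> A) g h (a b : int) :
  dot K x (fun i => g i * a + h i * b) = dot K x g *~ a + dot K x h *~ b.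
Proof.
rewrite /dot !mulrz_suml -big_split; apply: eq_bigr => i _ /=.
by rewrite mulrzDr !mulrzA.
Qed.

Lemma dotB (A : zmodType) K (x : nat -> A) g h :
  dot K x (fun i => g i - h i) = dot K x g - dot K x h.
Proof.
rewrite -[X in _ = X - _]mulr1z -[X in _ = _ - X]mulr1z -mulrNz -dot_comb.
by apply: eq_dot => // i _; rewrite mulr1 mulrN1.
Qed.

Lemma dotDl (A : zmodType) K (x y : nat -> A) g :
  dot K (fun i => x i + y i) g = dot K x g + dot K y g.
Proof.
by rewrite /dot -big_split; apply: eq_bigr => i _ /=; rewrite mulrzDl.
Qed.

Lemma dotMl (A : zmodType) K (x : nat -> A) (m : int) g :
  dot K (fun i => x i *~ m) g = dot K x g *~ m.
Proof.
by rewrite /dot mulrz_suml; apply: eq_bigr => i _; rewrite -!mulrzA mulrC.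
Qed.

Lemma dot_single (A : zmodType) K (c : A) (h g : nat -> int) :
  dot K (fun i => c *~ h i) g = c *~ dot K h g.
Proof.
rewrite /dot mulrz_sumr; apply: eq_bigr => i _.
by rewrite -mulrzA mulrzz.
Qed.

Lemma dot_exchange (A : zmodType) K r (b : nat -> A) (h : nat -> nat -> int) g :
  dot K (fun i => dot r b (h i)) g = dot r b (fun j => dot K (h^~ j) g).
Proof.
rewrite /dot; under eq_bigr do rewrite mulrz_suml.
rewrite exchange_big; apply: eq_bigr => j _ /=.
by rewrite mulrz_sumr; apply: eq_bigr => i _; rewrite -mulrzA mulrzz.
Qed.

Definition unit_form (i j : nat) : int := (i == j)%:R.

Lemma dot_unit (A : zmodType) K (x : nat -> A) i :
  (i < K)%N -> dot K x (unit_form i) = x i.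
Proof.
move=> iK; rewrite /dot (bigD1 (Ordinal iK)) //= /unit_form eqxx big1 ?addr0 //.
by move=> j; rewrite -val_eqE eq_sym /= => /negbTE ->.
Qed.

Lemma raddf_dot (A B : zmodType) (f : A -> B) K (x : nat -> A) g :
  zmod_morphism f -> f (dot K x g) = dot K (f \o x) g.
Proof.
move=> fB.
have f0 : f 0 = 0 by rewrite -(subrr 0) fB subrr.
have fN u : f (- u) = - f u by rewrite -sub0r fB f0 sub0r.
have fD u v : f (u + v) = f u + f v by rewrite -[v in LHS]opprK fB fN opprK.
have fMn u n : f (u *+ n) = f u *+ n.
  by elim: n => [|n IH]; rewrite ?mulr0n ?f0 // !mulrS fD IH.
have fMz u m : f (u *~ m) = f u *~ m.
  by case: m => n; rewrite ?NegzE ?mulrNz ?fN /intmul fMn.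
by elim: K => [|K IH]; rewrite /dot ?big_ord0 // -!/(dot _ _ _) !dotS fD IH fMz.
Qed.

Lemma seq_max (s : seq (rat * bool)) :
  s = [::] \/ exists2 m, m \in s & forall l, l \in s -> l.1 <= m.1.
Proof.
elim: s => [|a s [->|[m ms mP]]]; [by left| |]; right.
  by exists a; rewrite ?inE // => l; rewrite inE => /eqP ->.
have [am|/ltW ma] := lerP a.1 m.1.
  exists m; first by rewrite inE ms orbT.
  by move=> l; rewrite inE => /predU1P[->|/mP].
exists a; first by rewrite inE eqxx.
by move=> l; rewrite inE => /predU1P[->//|/mP /le_trans]; exact.
Qed.

Lemma seq_min (s : seq (rat * bool)) :
  s = [::] \/ exists2 m, m \in s & forall l, l \in s -> m.1 <= l.1.
Proof.
have [|[_ /mapP[a sa ->] mP]] := seq_max [seq (- a.1, a.2) | a <- s].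
  by case: s => //; left.
right; exists a => // l sl.
by have /= := mP (- l.1, l.2) (map_f _ sl); rewrite lerN2.
Qed.

Definition ineq (R : porderZmodType) (s : bool) (d : R) :=
  if s then 0 < d else 0 <= d.

Lemma ineqW (R : porderZmodType) s (d : R) : ineq s d -> 0 <= d.
Proof. by case: s => //= /ltW. Qed.

(** The witness is the midpoint of the largest lower and the smallest upper bound. If these
    coincide, no strict bound attains the common value: paired with the opposite extreme bound it
    would give a strict inequality between equal numbers. *)
Lemma between (lo up : seq (rat * bool)) :
  (forall l u, l \in lo -> u \in up -> ineq (l.2 || u.2) (u.1 - l.1)) ->
  exists z, (forall l, l \in lo -> ineq l.2 (z - l.1)) /\
            (forall u, u \in up -> ineq u.2 (u.1 - z)).
Proof.
move=> H; case: (seq_max lo) => [lo0|[m mlo mP]].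
  case: (seq_min up) => [up0|[n nup nP]].
    by exists 0; rewrite lo0 up0.
  exists (n.1 - 1); rewrite lo0; split => // u /nP.
  by case: u => [u []] /=; rewrite /ineq; lra.
case: (seq_min up) => [up0|[n nup nP]].
  exists (m.1 + 1); rewrite up0; split => // u /mP.
  by case: u => [u []] /=; rewrite /ineq; lra.
exists ((m.1 + n.1) / 2%:R); split.
  move=> l llo; have := mP _ llo; have := H _ _ llo nup; have := H _ _ mlo nup.
  by move/ineqW; case: l llo => [l []] _ /=; rewrite /ineq ?orbT /=; lra.
move=> l llo; have := nP _ llo; have := H _ _ mlo llo; have := H _ _ mlo nup.
by move/ineqW; case: l llo => [l []] _ /=; rewrite /ineq ?orbT /=; lra.
Qed.

(** * Fourier-Motzkin elimination for an abstract notion of positivity *)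

Section FourierMotzkin.
(** [S] is strict and [W] weak positivity. They are abstract because two meanings of [S] occur:
    [0 < z], and lying above a whole convex subgroup. The contradiction behind elimination is [S 0],
    met when no variable is left. *)
Variables (A : zmodType) (S W : A -> Prop).
Hypothesis S0 : ~ S 0.
Hypothesis SW : forall x, S x -> W x.
Hypothesis WD : forall x y, W x -> W y -> W (x + y).
Hypothesis SD : forall x y, S x -> W y -> S (x + y).

Let SWif (s : bool) x := if s then S x else W x.

Let SWifD s t x y : SWif s x -> SWif t y -> SWif (s || t) (x + y).
Proof.
case: s; case: t => /=; first by move=> Sx /SW; exact: SD.
- exact: SD.
- by rewrite addrC => Wx Sy; exact: SD.
- exact: WD.
Qed.

Let SWifM s x m : 0 < m -> SWif s x -> SWif s (x *~ m).
Proof.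
case: m => [[|m]|] // _ Hx; rewrite -pmulrn.
elim: m => // m IH; rewrite mulrS.
by have := SWifD Hx IH; rewrite orbb.
Qed.

(* Eliminating the last variable, each pair of a lower and an upper bound gives
   one new constraint, strict as soon as one of the two bounds is. *)
Lemma fourier_motzkin_rat K (x : nat -> A) (cs : seq ((nat -> int) * bool)) :
  (forall c, c \in cs -> if c.2 then S (dot K x c.1) else W (dot K x c.1)) ->
  exists y : nat -> rat, forall c, c \in cs -> ineq c.2 (dot K y c.1).
Proof.
elim: K cs => [|K IH] cs Hcs.
  exists (fun=> 0) => c /Hcs; rewrite /dot !big_ord0.
  by case: (c.2).
(* For a lower bound [c] and an upper bound [d] both multipliers are positive, and they cancel the
   last variable. *)
pose comb (c d : (nat -> int) * bool) : (nat -> int) * bool :=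
  ((fun i => c.1 i * (- d.1 K) + d.1 i * c.1 K), c.2 || d.2).
pose cs' := [seq c <- cs | c.1 K == 0] ++
  [seq comb c d | c <- [seq c <- cs | 0 < c.1 K],
                  d <- [seq d <- cs | d.1 K < 0]].
have [|y Hy] := IH cs'.
  move=> c; rewrite mem_cat mem_filter => /orP[/andP[/eqP cK /Hcs]|].
    by rewrite dotS cK mulr0z addr0.
  case/allpairsP => -[c1 c2] /= []; rewrite !mem_filter.
  move=> /andP[c1p /Hcs H1] /andP[c2n /Hcs H2] -> /=.
  have c2p : 0 < - c2.1 K by rewrite oppr_gt0.
  have := SWifD (SWifM c2p H1) (SWifM c1p H2); rewrite /SWif !dotS.
  suff -> : (dot K x c1.1 + x K *~ c1.1 K) *~ (- c2.1 K) +
     (dot K x c2.1 + x K *~ c2.1 K) *~ c1.1 K = dot K x (comb c1 c2).1 by [].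
  rewrite dot_comb !mulrzDl addrACA -[x K *~ c1.1 K *~ _]mulrzA.
  rewrite -[x K *~ c2.1 K *~ _]mulrzA mulrN mulrNz.
  by rewrite [c1.1 K * c2.1 K]mulrC [x K *~ - _]mulrNz addNr addr0.
pose lo : seq (rat * bool) :=
  [seq (- dot K y c.1 / (c.1 K)%:~R, c.2) | c <- [seq c <- cs | 0 < c.1 K]].
pose up : seq (rat * bool) :=
  [seq (- dot K y c.1 / (c.1 K)%:~R, c.2) | c <- [seq c <- cs | c.1 K < 0]].
have [|z [zlo zup]] := @between lo up.
  move=> l u /mapP[c + ->] /mapP[d + ->] /=; rewrite !mem_filter.
  move=> /andP[cp ccs] /andP[dn dcs].
  have : comb c d \in cs'.
    rewrite mem_cat; apply/orP; right; apply/allpairsP; exists (c, d).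
    by rewrite !mem_filter cp dn.
  move/Hy; rewrite /comb /= dot_comb.
  have cp' : 0 < (c.1 K)%:~R :> rat by rewrite ltr0z.
  have dn' : 0 < - (d.1 K)%:~R :> rat by rewrite oppr_gt0 ltrz0.
  set u0 := dot K y c.1; set v0 := dot K y d.1.
  have e0 : - v0 / (d.1 K)%:~R - - u0 / (c.1 K)%:~R =
     (u0 *~ - d.1 K + v0 *~ c.1 K) / (- (d.1 K)%:~R * (c.1 K)%:~R).
    rewrite -[u0 *~ _]mulrzr -[v0 *~ _]mulrzr rmorphN /=; field.
    by rewrite (gt_eqF cp') -oppr_eq0 (gt_eqF dn').
  rewrite e0 /ineq; case: (_ || _).
    by move=> h; rewrite divr_gt0 // mulr_gt0.
  by move=> h; rewrite divr_ge0 // mulr_ge0 // ltW.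
exists (fun i => if i == K then z else y i) => c ccs.
rewrite dotS eqxx (@eq_dot _ _ _ y _ c.1) //; last first.
  by move=> i iK; rewrite (ltn_eqF iK).
have [cn|cp|c0] := ltgtP (c.1 K) 0.
- have cup : (- dot K y c.1 / (c.1 K)%:~R, c.2) \in up.
    by apply/mapP; exists c => //; rewrite mem_filter cn.
  have dn' : 0 < - (c.1 K)%:~R :> rat by rewrite oppr_gt0 ltrz0.
  have := zup _ cup => /=; set w := dot _ _ _.
  have -> : w + z *~ c.1 K = (- w / (c.1 K)%:~R - z) * - (c.1 K)%:~R.
    rewrite -mulrzr; field; by rewrite -oppr_eq0 (gt_eqF dn').
  by rewrite /ineq; case: (c.2) => h; [rewrite mulr_gt0|rewrite mulr_ge0 // ltW].
- have cup : (- dot K y c.1 / (c.1 K)%:~R, c.2) \in lo.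
    by apply/mapP; exists c => //; rewrite mem_filter cp.
  have dn' : 0 < (c.1 K)%:~R :> rat by rewrite ltr0z.
  have := zlo _ cup => /=; set w := dot _ _ _.
  have -> : w + z *~ c.1 K = (z - - w / (c.1 K)%:~R) * (c.1 K)%:~R.
    rewrite -mulrzr; field; by rewrite (gt_eqF dn').
  by rewrite /ineq; case: (c.2) => h; [rewrite mulr_gt0|rewrite mulr_ge0 // ltW].
- rewrite c0 mulr0z addr0; apply: Hy.
  by rewrite mem_cat mem_filter c0 eqxx ccs.
Qed.

Lemma common_denominator K (y : nat -> rat) :
  exists2 D : int, 0 < D & exists z : nat -> int,
    forall i, (i < K)%N -> (z i)%:~R = y i * D%:~R.
Proof.
elim: K => [|K [D D0 [z Hz]]]; first by exists 1 => //; exists (fun=> 0).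
exists (D * denq (y K)); first by rewrite mulr_gt0 // denq_gt0.
exists (fun i => if i == K then numq (y K) * D else z i * denq (y K)) => i.
rewrite ltnS leq_eqVlt => /predU1P[->|iK].
  rewrite eqxx !intrM numqE; ring.
by rewrite (ltn_eqF iK) !intrM Hz //; ring.
Qed.

(** The constraints are homogeneous, so denominators can be cleared. *)
Lemma fourier_motzkin K (x : nat -> A) (cs : seq ((nat -> int) * bool)) :
  (forall c, c \in cs -> if c.2 then S (dot K x c.1) else W (dot K x c.1)) ->
  exists y : nat -> int, forall c, c \in cs -> ineq c.2 (dot K y c.1).
Proof.
move=> /fourier_motzkin_rat[y Hy]; have [D D0 [z Hz]] := common_denominator K y.
exists z => c /Hy.
have D0' : 0 < D%:~R :> rat by rewrite ltr0z.
have <- : (dot K z c.1)%:~R / D%:~R = dot K y c.1.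
  apply: (canLR (mulfK (lt0r_neq0 D0'))).
  rewrite (@raddf_dot _ _ (intmul 1)); last exact: rmorphB.
  rewrite mulrzr -dotMl; apply: eq_dot => // i iK; rewrite -[LHS]/((z i)%:~R).
  by rewrite Hz // mulrzr.
rewrite /ineq; case: (c.2).
  by rewrite pmulr_lgt0 ?invr_gt0 // ltr0z.
by rewrite pmulr_lge0 ?invr_gt0 // ler0z.
Qed.

End FourierMotzkin.

(** * Bases modulo a pure subgroup *)

Section PureBasis.
Variables (A : zmodType) (S : A -> Prop).
Hypothesis S0 : S 0.
Hypothesis SB : forall x y, S x -> S y -> S (x - y).
Hypothesis Spure : forall x m, m != 0 -> S (x *~ m) -> S x.

Let SN x : S x -> S (- x).
Proof. by move=> Sx; rewrite -sub0r; exact: SB. Qed.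

Let SD x y : S x -> S y -> S (x + y).
Proof. by move=> Sx Sy; rewrite -[y]opprK; apply: SB => //; exact: SN. Qed.

Let SMn x n : S x -> S (x *+ n).
Proof.
by move=> Sx; elim: n => [|n IH]; rewrite ?mulr0n // mulrS; exact: SD.
Qed.

Let SM x m : S x -> S (x *~ m).
Proof.
move=> Sx; case: m => m; first exact: SMn.
by rewrite NegzE mulrNz; apply/SN/SMn.
Qed.

(* The Smith normal form of the single row [g] turns the relation [g] into one
   that involves a single member of a new generating family, which purity then
   puts in [S]. *)
Lemma drop_dependent r (b : nat -> A) (g : nat -> int) (j0 : nat) :
  (j0 < r.+1)%N -> g j0 != 0 -> S (dot r.+1 b g) ->
  exists (b' : nat -> A) (h : nat -> nat -> int),
    forall j, (j < r.+1)%N -> S (b j - dot r b' (h j)).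
Proof.
move=> j0r gj0 Sg.
pose M : 'M[int]_(1, r.+1) := \matrix_(i < 1, j < r.+1) g j.
have [L _ [R uR [d _ MLR]]] := int_Smith_normal_form M.
pose b' (i : nat) := dot r.+1 b (fun j => R (inord i) (inord j)).
(* A one-row Smith form has a single diagonal entry, so [g] is a multiple of row [0] of the
   invertible matrix [R]. In the family [b'], which is [R] applied to [b], the relation is a
   multiple of [b' 0]. *)
have gE (j : 'I_r.+1) : g j = L 0 0 * d`_0 * R 0 j.
  have := congr1 (fun N : 'M_(1, r.+1) => N 0 j) MLR; rewrite !mxE => ->.
  rewrite (bigD1 0) //= big1 ?addr0 => [|i i0].
    by rewrite !mxE big_ord1 !mxE.
  rewrite !mxE big_ord1 !mxE.
  by move: i0; rewrite -val_eqE /= eq_sym => /negbTE ->; rewrite mulr0 mul0r.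
have Ld0 : L 0 0 * d`_0 != 0.
  by apply: contra gj0 => /eqP e; rewrite (gE (Ordinal j0r)) e mul0r.
have Sb'0 : S (b' 0%N).
  apply: (Spure Ld0); suff <- : dot r.+1 b g = b' 0%N *~ (L 0 0 * d`_0) by [].
  rewrite /b' /dot mulrz_suml; apply: eq_bigr => j _.
  rewrite gE -mulrzA mulrC; congr (_ *~ (R _ _ * _)); apply: val_inj => /=.
    by rewrite inordK.
  by rewrite inordK.
have bE (j : nat) : (j < r.+1)%N ->
    b j = dot r.+1 b' (fun i => invmx R (inord j) (inord i)).
  move=> jr; rewrite /b' dot_exchange.
  rewrite (@eq_dot _ _ _ b _ (unit_form j)) ?dot_unit // => i ir.
  have := congr1 (fun N : 'M_r.+1 => N (inord j) (inord i)) (mulVmx uR).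
  rewrite !mxE /unit_form -val_eqE /= !inordK // => <-; rewrite /dot.
  by apply: eq_bigr => k _; rewrite mulrzz mulrC inord_val.
exists (fun i => b' i.+1), (fun j i => invmx R (inord j) (inord i.+1)) => j jr.
rewrite {1}bE // /dot big_ord_recl /= addrK.
exact: SM.
Qed.

(** This is freeness of finitely generated torsion-free groups, applied modulo [S]. A spanning
    family of least length is independent, since [drop_dependent] would shorten it along any
    nontrivial relation. *)
Lemma pure_basis K (x : nat -> A) :
  exists r (b : nat -> A) (h : nat -> nat -> int),
    (forall i, (i < K)%N -> S (x i - dot r b (h i))) /\
    (forall g, S (dot r b g) -> forall j, (j < r)%N -> g j = 0).
Proof.
pose spans r := exists (b : nat -> A) (h : nat -> nat -> int),
  forall i, (i < K)%N -> S (x i - dot r b (h i)).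
have : exists r, `[< spans r >].
  exists K; apply/asboolP; exists x, unit_form => i iK.
  by rewrite dot_unit // subrr.
case/ex_minnP => r /asboolP[b [h Hb]] rmin.
exists r, b, h; split => // g Sg j jr; apply/eqP/negP => /negP gj.
case: r => // r in rmin Hb Sg jr *.
have [b' [h' Hb']] := drop_dependent jr gj Sg.
suff /rmin : `[< spans r >] by rewrite ltnn.
apply/asboolP; exists b', (fun i l => dot r.+1 (h'^~ l) (h i)) => i iK.
rewrite -dot_exchange -[x i](subrK (dot r.+1 b (h i))) -addrA.
apply: SD; first exact: Hb.
have -> : dot r.+1 b (h i) - dot r.+1 (fun j => dot r b' (h' j)) (h i) =
    dot r.+1 (fun j => b j - dot r b' (h' j)) (h i).
  rewrite -[X in X - _](@eq_dot _ _ (fun j => b j - dot r b' (h' j) +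
    dot r b' (h' j)) _ (h i)) => [|k _|//]; last by rewrite subrK.
  by rewrite dotDl addrK.
rewrite /dot; elim/big_ind: _ => // k _.
exact/SM/Hb'.
Qed.

End PureBasis.

(** * Terms and varieties *)

Section LGroupOrder.
Variable L : lgroupType.
Implicit Types x y z w : L.

Lemma lg_subr_ge0 x y : (0 <= y - x) = (x <= y).
Proof.
apply/idP/idP => [|/lgroup_le0B//].
by move=> /(lgroup_leD2r x); rewrite add0r subrK.
Qed.

Lemma lg_subr_gt0 x y : (0 < y - x) = (x < y).
Proof. by rewrite !lt_def lg_subr_ge0 subr_eq0. Qed.

Lemma lg_leD2r z x y : (x + z <= y + z) = (x <= y).
Proof. by rewrite -[LHS]lg_subr_ge0 opprD addrACA subrr addr0 lg_subr_ge0. Qed.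

Lemma lg_leD2l z x y : (z + x <= z + y) = (x <= y).
Proof. by rewrite ![z + _]addrC lg_leD2r. Qed.

Lemma lg_leD x y z w : x <= y -> z <= w -> x + z <= y + w.
Proof.
move=> xy zw; apply: le_trans (lgroup_leD2l y zw).
exact: lgroup_leD2r.
Qed.

Lemma lg_ltD2r z x y : (x + z < y + z) = (x < y).
Proof. by rewrite -[LHS]lg_subr_gt0 opprD addrACA subrr addr0 lg_subr_gt0. Qed.

Lemma lg_ltD2l z x y : (z + x < z + y) = (x < y).
Proof. by rewrite ![z + _]addrC lg_ltD2r. Qed.

Lemma lg_lt_leD x y z w : x < y -> z <= w -> x + z < y + w.
Proof.
move=> xy zw; apply: lt_le_trans (lgroup_leD2l y zw).
by rewrite lg_ltD2r.
Qed.

Lemma lg_leN2 x y : (- x <= - y) = (y <= x).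
Proof. by rewrite -[LHS]lg_subr_ge0 opprK addrC lg_subr_ge0. Qed.

Lemma lg_ltN2 x y : (- x < - y) = (y < x).
Proof. by rewrite -[LHS]lg_subr_gt0 opprK addrC lg_subr_gt0. Qed.

Lemma lg_oppr_ge0 x : (0 <= - x) = (x <= 0).
Proof. by rewrite -{1}oppr0 lg_leN2. Qed.

Lemma lg_leBlDr x y z : (x - y <= z) = (x <= z + y).
Proof. by rewrite -[LHS](lg_leD2r y) subrK. Qed.

Lemma lg_ltBrDr x y z : (x < y - z) = (x + z < y).
Proof. by rewrite -[LHS](lg_ltD2r z) subrK. Qed.

Lemma lg_addr_ge0 x y : 0 <= x -> 0 <= y -> 0 <= x + y.
Proof. by move=> x0 y0; rewrite -[0]addr0 lg_leD. Qed.

Lemma lg_mulrn_ge0 x n : 0 <= x -> 0 <= x *+ n.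
Proof.
by move=> x0; elim: n => [|n IH]; rewrite ?mulr0n // mulrS lg_addr_ge0.
Qed.

Lemma lg_mulz_ge0 x (m : int) : 0 <= x -> 0 <= m -> 0 <= x *~ m.
Proof. by case: m => // n x0 _; exact: lg_mulrn_ge0. Qed.

Lemma lg_mulz_gt0 x (m : int) : 0 < x -> 0 < m -> 0 < x *~ m.
Proof.
case: m => [[|n]|] // x0 _; rewrite -pmulrn mulrS -[0]addr0 lg_lt_leD //.
exact/lg_mulrn_ge0/ltW.
Qed.

Lemma lg_ltz x : 0 < x -> {mono intmul x : m n / m < n}.
Proof.
move=> x0; apply: leW_mono; apply: le_mono => m n mn.
by rewrite -lg_subr_gt0 -mulrzBr lg_mulz_gt0 // subr_gt0.
Qed.

Lemma lg_lez x : 0 < x -> {mono intmul x : m n / m <= n}.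
Proof.
move=> x0; apply: le_mono => m n mn.
by rewrite -lg_subr_gt0 -mulrzBr lg_mulz_gt0 // subr_gt0.
Qed.

Lemma lg_lez2r (m : int) x y : 0 <= m -> x <= y -> x *~ m <= y *~ m.
Proof. by move=> m0 xy; rewrite -lg_subr_ge0 -mulrzBl lg_mulz_ge0 // lgroup_le0B. Qed.

Lemma lg_lenr x (m n : nat) : 0 <= x -> (m <= n)%N -> x *+ m <= x *+ n.
Proof.
move=> x0 mn; rewrite -(subnK mn) mulrnDr -{1}[x *+ m]add0r lg_leD2r.
exact: lg_mulrn_ge0.
Qed.

Lemma lmeet_l x y : x <= y -> lmeet x y = x.
Proof. by move=> xy; apply/le_anti; rewrite lmeet_lel lmeetP lexx. Qed.

Lemma lmeet_r x y : y <= x -> lmeet x y = y.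
Proof. by move=> xy; apply/le_anti; rewrite lmeet_ler lmeetP lexx xy. Qed.

Lemma ljoin_l x y : y <= x -> ljoin x y = x.
Proof. by move=> xy; apply/le_anti; rewrite le_ljoinl ljoinP lexx xy. Qed.

Lemma ljoin_r x y : x <= y -> ljoin x y = y.
Proof. by move=> xy; apply/le_anti; rewrite le_ljoinr ljoinP lexx xy. Qed.

End LGroupOrder.

Section TotalLGroup.
Variables (L : lgroupType) (Ltot : totally_ordered L).
Implicit Types x y z : L.

Lemma lg_leNgt x y : (x <= y) = ~~ (y < x).
Proof.
apply/idP/idP => [xy|]; first by apply/negP => /(le_lt_trans xy); rewrite ltxx.
case: (lex_cmpP Ltot x y) => [/ltW //|//|-> _]; exact: lexx.
Qed.

Lemma lg_ltNge x y : (x < y) = ~~ (y <= x).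
Proof. by rewrite lg_leNgt negbK. Qed.

(* In a total order, meets and joins are determined by comparisons, so
   monotonicity is all that has to be checked. *)
Lemma monotone_lgroup_hom (M : lgroupType) (f : L -> M) :
  zmod_morphism f -> {homo f : x y / x <= y} -> lgroup_hom f.
Proof.
move=> fB fle; split => // x y; case/orP: (Ltot x y) => xy.
- by rewrite !lmeet_l ?fle.
- by rewrite !lmeet_r ?fle.
- by rewrite !ljoin_r ?fle.
- by rewrite !ljoin_l ?fle.
Qed.

Lemma le0_ljoin x y : (0 <= ljoin x y) = (0 <= x) || (0 <= y).
Proof.
case/orP: (Ltot x y) => xy.
  rewrite ljoin_r //; apply/idP/orP => [->|[/le_trans ->//|//]]; by right.
rewrite ljoin_l //; apply/idP/orP => [->|[//|/le_trans ->//]]; by left.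
Qed.

(** Adding [c *+ m] makes [x] nonnegative, so the quotient is found by minimality in [nat] and then
    shifted back by [m]. *)
Lemma lg_floor c x (m : nat) : 0 < c -> - (c *+ m) <= x -> x <= c *+ m ->
  exists k : int, c *~ k <= x /\ x < c *~ (k + 1).
Proof.
move=> c0 mx xm.
have : exists n : nat, x + c *+ m < c *+ n.+1.
  exists (m + m)%N; apply: (@le_lt_trans _ _ (c *+ (m + m))).
    by rewrite mulrnDr lg_leD2r.
  by rewrite mulrSr -{1}[_ *+ _]addr0 lg_ltD2l.
case/ex_minnP => n xn nmin; exists (n%:Z - m%:Z); split.
  rewrite mulrzBr lg_leBlDr; case: n xn nmin => [|n] xn nmin.
    by rewrite mulr0z -lg_leBlDr sub0r.
  by rewrite lg_leNgt; apply/negP => /nmin; rewrite ltnn.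
by rewrite addrAC mulrzBr lg_ltBrDr -PoszD addn1; exact: xn.
Qed.

End TotalLGroup.

(** Subtraction alone yields the group operations, 0 being [x - x]. The variable type is a parameter
    because the free algebra takes the elements of [A] as variables. *)
Inductive tm (V : Type) :=
  | TVar of V
  | TSub of tm V & tm V
  | TMeet of tm V & tm V
  | TJoin of tm V & tm V.

Fixpoint eval (L : lgroupType) V (x : V -> L) (t : tm V) : L :=
  match t with
  | TVar i => x i
  | TSub s t => eval x s - eval x t
  | TMeet s t => lmeet (eval x s) (eval x t)
  | TJoin s t => ljoin (eval x s) (eval x t)
  end.

Fixpoint tmap V W (f : V -> W) (t : tm V) : tm W :=
  match t with
  | TVar i => TVar (f i)
  | TSub s t => TSub (tmap f s) (tmap f t)
  | TMeet s t => TMeet (tmap f s) (tmap f t)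
  | TJoin s t => TJoin (tmap f s) (tmap f t)
  end.

Fixpoint tvars V (t : tm V) : seq V :=
  match t with
  | TVar i => [:: i]
  | TSub s t | TMeet s t | TJoin s t => tvars s ++ tvars t
  end.

(** The number of variable occurrences, which serves as the Lipschitz constant of [t]. *)
Fixpoint term_size V (t : tm V) : nat :=
  match t with
  | TVar i => 1
  | TSub s t | TMeet s t | TJoin s t => term_size s + term_size t
  end.

Lemma eval_tmap (L : lgroupType) V W (f : V -> W) (x : W -> L) t :
  eval x (tmap f t) = eval (x \o f) t.
Proof. by elim: t => //= s -> t ->. Qed.

Lemma eval_ext (L : lgroupType) (V : eqType) (x y : V -> L) t :
  {in tvars t, x =1 y} -> eval x t = eval y t.
Proof.
elim: t => [i|s IHs t IHt|s IHs t IHt|s IHs t IHt] /= xy;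
  first by apply: xy; rewrite inE.
all: by rewrite IHs ?IHt // => i ti; apply: xy; rewrite mem_cat ti ?orbT.
Qed.

Lemma eval_hom (L M : lgroupType) (f : L -> M) V (x : V -> L) t :
  lgroup_hom f -> f (eval x t) = eval (f \o x) t.
Proof.
by move=> [fB fI fU]; elim: t => //= s <- t <-; rewrite ?fB ?fI ?fU.
Qed.

Lemma eval_prod (I : Type) (F : I -> lgroupType) V
    (x : V -> prod_lgroup F) t i :
  eval x t i = eval (fun v => x v i) t.
Proof. by elim: t => //= s <- t <-. Qed.

Lemma zmod_morphism0 (A B : zmodType) (f : A -> B) : zmod_morphism f -> f 0 = 0.
Proof. by move=> fB; rewrite -(subrr 0) fB subrr. Qed.

Lemma lgroup_hom_le (L M : lgroupType) (f : L -> M) :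
  lgroup_hom f -> {homo f : x y / x <= y}.
Proof. by move=> [_ fI _] x y /lmeet_l e; rewrite -e fI lmeet_ler. Qed.

(* The variable [0] stands for the point. *)
Definition valid (A : plgroup) (t : tm nat) : Prop :=
  forall x : nat -> A, x 0%N = plpt A -> 0 <= eval x t.

Definition entails (B A : plgroup) : Prop := forall t, valid B t -> valid A t.

Lemma entails_trans B A C : entails A B -> entails B C -> entails A C.
Proof. by move=> AB BC t /AB /BC. Qed.

(** The algebra of term functions need not be convex in the power it lives in, so subalgebras are
    built here without convexity. *)
Record lSubgroup (L : lgroupType) := LSubgroup {
  lsub_set : set L;
  lsub_setP : lsubgroup lsub_set
}.

Section SubLGroup.
Variables (L : lgroupType) (C : lSubgroup L).

Definition lsub_pred : {pred L} := fun x => x \in lsub_set C.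

Lemma lsub_predP (x : L) : reflect (lsub_set C x) (x \in lsub_pred).
Proof. by apply: (iffP idP) => [/set_mem|/mem_set]. Qed.

Fact lsub_zmod_closed : zmod_closed lsub_pred.
Proof.
have [C0 CB _ _] := lsub_setP C.
by split=> [|x y /lsub_predP Cx /lsub_predP Cy]; apply/lsub_predP => //; exact: CB.
Qed.

HB.instance Definition _ := GRing.isZmodClosed.Build L lsub_pred lsub_zmod_closed.

Definition lsub_type : Type := {x : L | lsub_pred x}.

HB.instance Definition _ := SubChoice.on lsub_type.
HB.instance Definition _ := [SubChoice_isSubZmodule of lsub_type by <:].
HB.instance Definition _ :=
  [SubChoice_isSubPOrder of lsub_type by <: with ring_display].

Fact lsub_meet_subproof (x y : lsub_type) : lsub_pred (lmeet (val x) (val y)).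
Proof.
have [_ _ CI _] := lsub_setP C.
by apply/lsub_predP; apply: CI; apply/lsub_predP; exact: valP.
Qed.

Fact lsub_join_subproof (x y : lsub_type) : lsub_pred (ljoin (val x) (val y)).
Proof.
have [_ _ _ CU] := lsub_setP C.
by apply/lsub_predP; apply: CU; apply/lsub_predP; exact: valP.
Qed.

Definition lsub_meet (x y : lsub_type) : lsub_type :=
  Sub _ (lsub_meet_subproof x y).

Definition lsub_join (x y : lsub_type) : lsub_type :=
  Sub _ (lsub_join_subproof x y).

Fact lsub_meetP (x y z : lsub_type) :
  (x <= lsub_meet y z) = (x <= y) && (x <= z).
Proof. exact: lmeetP. Qed.

Fact lsub_joinP (x y z : lsub_type) :
  (lsub_join x y <= z) = (x <= z) && (y <= z).
Proof. exact: ljoinP. Qed.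

Fact lsub_leD2l (z x y : lsub_type) : x <= y -> z + x <= z + y.
Proof. exact: lgroup_leD2l. Qed.

Definition lsub_lgroup : lgroupType :=
  LGroup lsub_type lsub_meet lsub_join lsub_meetP lsub_joinP lsub_leD2l.

Lemma lsub_val_hom : @lgroup_hom lsub_lgroup L val.
Proof. by split. Qed.

End SubLGroup.

Lemma HSP1_entails (A B : plgroup) : HSP1 B A -> entails B A.
Proof.
move=> [C [f [[D [g [[I [F [FB [h [hhom hpt] hbij]]]] [ghom gpt] ginj]]]]]].
move=> [fhom fpt] fsurj t tB.
have tD : valid D t.
  have [hB _ _] := hhom.
  move=> x x0; rewrite -lg_subr_ge0 subr0.
  have : 0 <= h (eval x t).
    apply/asboolP => i; rewrite (eval_hom _ _ hhom) eval_prod.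
    have : valid (F i) t by rewrite (FB i).
    by apply; rewrite /= x0 hpt.
  (* [0 <= z] is the equation [lmeet 0 z = 0], so an injective homomorphism reflects it. *)
  move=> /lmeet_l; have [_ hI _] := hhom.
  rewrite -{1}(zmod_morphism0 hB) -hI -(zmod_morphism0 hB).
  by move=> /(bij_inj hbij) <-; exact: lmeet_ler.
have tC : valid C t.
  have [gB gI _] := ghom.
  move=> x x0; have : 0 <= eval (g \o x) t by apply: tD; rewrite /= x0.
  rewrite -(eval_hom _ _ ghom) => /lmeet_l.
  rewrite -{1}(zmod_morphism0 gB) -gI -(zmod_morphism0 gB).
  by move=> /ginj <-; exact: lmeet_ler.
move=> x x0.
(* Variable [0] must be lifted to the point of [C] itself, not to an arbitrary preimage of the point
   of [A]. *)
pose y i := if i == 0%N then plpt C else projT1 (cid (fsurj (x i))).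
have -> : x = f \o y.
  apply: funext => i; rewrite /y /=; case: eqP => [->|_]; first by rewrite fpt.
  by rewrite (projT2 (cid (fsurj (x i)))).
rewrite -(eval_hom _ _ fhom) -(zmod_morphism0 (let: And3 fB _ _ := fhom in fB)).
by apply: (lgroup_hom_le fhom); exact: tC.
Qed.

(** A term has finitely many variables; they are renumbered by their position in a list headed by
    [v0], which thus becomes variable [0]. *)
Lemma entails_any_vars (A B : plgroup) (V : choiceType) (v0 : V) :
  entails B A -> forall t : tm V,
  (forall y : V -> B, y v0 = plpt B -> 0 <= eval y t) ->
  forall x : V -> A, x v0 = plpt A -> 0 <= eval x t.
Proof.
move=> BA t tB x x0.
pose s := v0 :: tvars t.
have -> : eval x t = eval (x \o nth v0 s) (tmap (index^~ s) t).
  rewrite eval_tmap; apply: eval_ext => v vt /=.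
  by rewrite [nth _ _ _]nth_index // inE vt orbT.
apply: BA => // y y0; rewrite eval_tmap; apply: tB.
by rewrite /= eqxx.
Qed.

Section FreeAlgebra.
Variables (A B : plgroup) (BA : entails B A).

Let I := {w : A -> B | w (plpt A) = plpt B}.
Let P : plgroup := plprod (fun _ : I => B).
Let gen (a : A) : P := fun w => sval w a.
Let T : set P := [set p | exists t : tm A, p = eval gen t].

Let Tsub : lsubgroup T.
Proof.
split.
- exists (TSub (TVar (plpt A)) (TVar (plpt A))) => /=; by rewrite subrr.
- by move=> _ _ [s ->] [t ->]; exists (TSub s t).
- by move=> _ _ [s ->] [t ->]; exists (TMeet s t).
- by move=> _ _ [s ->] [t ->]; exists (TJoin s t).
Qed.

Let C := LSubgroup Tsub.

Let Cpt : lsub_pred C (plpt P).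
Proof.
apply/lsub_predP; exists (TVar (plpt A)); apply: functional_extensionality_dep.
by case.
Qed.

Let term_of (p : lsub_lgroup C) : tm A :=
  projT1 (cid (elimT (lsub_predP C (val p)) (valP p))).

Let term_ofP p : val p = eval gen (term_of p).
Proof. exact: (projT2 (cid (elimT (lsub_predP C (val p)) (valP p)))). Qed.

Let eval_mono (s t : tm A) : eval gen s <= eval gen t -> eval id s <= eval id t.
Proof.
move=> /asboolP st; rewrite -lg_subr_ge0 -/(eval id (TSub t s)).
apply: (entails_any_vars (v0 := plpt A) BA) => // y y0 /=.
rewrite lg_subr_ge0; have := st (exist _ y y0).
by rewrite !eval_prod.
Qed.

Let eval_eq (s t : tm A) : eval gen s = eval gen t -> eval id s = eval id t.
Proof. by move=> st; apply/le_anti; rewrite !eval_mono // st. Qed.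

(** [T] is the free algebra over the generators [a : A], realized as term functions on the
    point-preserving maps from [A] to [B]. It maps onto [A] by sending [gen a] to [a]; by [eval_eq]
    the choice of a representing term is immaterial, and this is where entailment enters. *)
Lemma entails_HSP1 : HSP1 B A.
Proof.
exists (PLGroup (lsub_lgroup C) (Sub (plpt P) Cpt)).
exists (fun p => eval id (term_of p)); split.
- exists P, val; split; [|by split => //; exact: lsub_val_hom|exact: val_inj].
  exists I, (fun _ => B); split => //.
  by exists id; [split; [split|]|exists id].
- split; [split|] => [p q|p q|p q|].
  + rewrite -/(eval id (TSub (term_of p) (term_of q))).
    by apply: eval_eq => /=; rewrite -!term_ofP.
  + rewrite -/(eval id (TMeet (term_of p) (term_of q))).
    by apply: eval_eq => /=; rewrite -!term_ofP.
  + rewrite -/(eval id (TJoin (term_of p) (term_of q))).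
    by apply: eval_eq => /=; rewrite -!term_ofP.
  + rewrite -[RHS]/(eval id (TVar (plpt A))).
    apply: eval_eq => /=; rewrite -!term_ofP.
    by apply: functional_extensionality_dep; case.
- move=> a; have Ca : lsub_pred C (gen a) by apply/lsub_predP; exists (TVar a).
  exists (Sub (gen a) Ca); rewrite -[RHS]/(eval id (TVar a)).
  by apply: eval_eq; rewrite -!term_ofP.
Qed.

End FreeAlgebra.

Lemma HSP1P (A B : plgroup) : HSP1 B A <-> entails B A.
Proof. by split; [exact: HSP1_entails|exact: entails_HSP1]. Qed.

Lemma same_HSP1P (A B : plgroup) :
  same_class (HSP1 A) (HSP1 B) <-> entails A B /\ entails B A.
Proof.
split=> [AB|[AB BA] C].
  by split; apply/HSP1P/AB/HSP1P.
by rewrite !HSP1P; split; exact: entails_trans.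
Qed.

(** * Moving refutations between algebras *)

Lemma entails_by_refutation (A B : plgroup) : totally_ordered A ->
  (forall t (x : nat -> A), x 0%N = plpt A -> eval x t < 0 ->
    exists y : nat -> B, y 0%N = plpt B /\ eval y t < 0) ->
  entails B A.
Proof.
move=> Atot H t tB x x0; rewrite lg_leNgt //; apply/negP => /(H _ _ x0)[y [y0 yt]].
by have := le_lt_trans (tB y y0) yt; rewrite ltxx.
Qed.

(* On the polyhedral cone where all comparisons made while evaluating [t] come
   out as they do at [x], the term [t] is given by one linear form. *)
Lemma linear_piece (L : lgroupType) K (x : nat -> L) (t : tm nat) :
  totally_ordered L -> all (fun i => i < K)%N (tvars t) ->
  exists (cs : seq (nat -> int)) (l : nat -> int),
    (forall g, g \in cs -> 0 <= dot K x g) /\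
    forall (M : lgroupType) (y : nat -> M),
      (forall g, g \in cs -> 0 <= dot K y g) -> eval y t = dot K y l.
Proof.
move=> Ltot; elim: t => [i|s IHs t IHt|s IHs t IHt|s IHs t IHt] /=.
- rewrite andbT => iK; exists [::], (unit_form i); split => // M y _.
  by rewrite dot_unit.
all: rewrite all_cat => /andP[/IHs[cs [l [xs Hs]]] /IHt[ct [m [xt Ht]]]].
- exists (cs ++ ct), (fun i => l i - m i); split.
    by move=> g; rewrite mem_cat => /orP[/xs|/xt].
  move=> M y My; rewrite dotB Hs ?Ht // => g gc; apply: My;
  by rewrite mem_cat gc ?orbT.
- case/orP: (Ltot (eval x s) (eval x t)) => st; have := st;
    rewrite (Hs _ _ xs) (Ht _ _ xt) -lg_subr_ge0 -dotB => st'.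
    exists ((fun i => m i - l i) :: cs ++ ct), l; split.
      by move=> g; rewrite inE mem_cat => /or3P[/eqP ->|/xs|/xt].
    move=> M y My; rewrite Hs ?Ht; first last.
    - by move=> g gc; apply: My; rewrite inE mem_cat gc !orbT.
    - by move=> g gc; apply: My; rewrite inE mem_cat gc !orbT.
    by apply: lmeet_l; rewrite -lg_subr_ge0 -dotB My ?inE ?eqxx.
  exists ((fun i => l i - m i) :: cs ++ ct), m; split.
    by move=> g; rewrite inE mem_cat => /or3P[/eqP ->|/xs|/xt].
  move=> M y My; rewrite Hs ?Ht; first last.
  - by move=> g gc; apply: My; rewrite inE mem_cat gc !orbT.
  - by move=> g gc; apply: My; rewrite inE mem_cat gc !orbT.
  by apply: lmeet_r; rewrite -lg_subr_ge0 -dotB My ?inE ?eqxx.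
- case/orP: (Ltot (eval x s) (eval x t)) => st; have := st;
    rewrite (Hs _ _ xs) (Ht _ _ xt) -lg_subr_ge0 -dotB => st'.
    exists ((fun i => m i - l i) :: cs ++ ct), m; split.
      by move=> g; rewrite inE mem_cat => /or3P[/eqP ->|/xs|/xt].
    move=> M y My; rewrite Hs ?Ht; first last.
    - by move=> g gc; apply: My; rewrite inE mem_cat gc !orbT.
    - by move=> g gc; apply: My; rewrite inE mem_cat gc !orbT.
    by apply: ljoin_r; rewrite -lg_subr_ge0 -dotB My ?inE ?eqxx.
  exists ((fun i => l i - m i) :: cs ++ ct), l; split.
    by move=> g; rewrite inE mem_cat => /or3P[/eqP ->|/xs|/xt].
  move=> M y My; rewrite Hs ?Ht; first last.
  - by move=> g gc; apply: My; rewrite inE mem_cat gc !orbT.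
  - by move=> g gc; apply: My; rewrite inE mem_cat gc !orbT.
  by apply: ljoin_l; rewrite -lg_subr_ge0 -dotB My ?inE ?eqxx.
Qed.

Definition sat (L : lgroupType) K (x : nat -> L) (cs : seq ((nat -> int) * bool)) :=
  forall c, c \in cs -> ineq c.2 (dot K x c.1).

Lemma entails_by_constraints (A B : plgroup) : totally_ordered A ->
  (forall K (x : nat -> A) cs, (0 < K)%N -> x 0%N = plpt A -> sat K x cs ->
    exists y : nat -> B, y 0%N = plpt B /\ sat K y cs) ->
  entails B A.
Proof.
move=> Atot H; apply: entails_by_refutation => // t x x0 xt.
pose K := (\max_(i <- tvars t) i).+1.
have Kt : all (fun i => i < K)%N (tvars t).
  by apply/allP => i it; rewrite ltnS; exact: leq_bigmax_seq.
have [cs [l [xcs Hl]]] := linear_piece x Atot Kt.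
pose cs' := (fun i => 0 - l i, true) :: [seq (g, false) | g <- cs].
have dotN (M : lgroupType) (y : nat -> M) :
    dot K y (fun i => 0 - l i) = - dot K y l.
  by rewrite (dotB _ _ (fun=> 0)) [dot _ _ _]big1 ?sub0r // => i _; rewrite mulr0z.
have [c|y [y0 Hy]] := H K x cs' isT x0.
  rewrite inE => /predU1P[->|/mapP[g /xcs ? ->//]].
  by rewrite /= dotN -oppr0 lg_ltN2 -Hl.
exists y; split => //.
rewrite Hl; last by move=> g gcs; apply: (Hy (g, false)); rewrite inE map_f ?orbT.
rewrite -lg_ltN2 oppr0 -dotN.
by apply: (Hy (_, true)); rewrite inE eqxx.
Qed.

(** Both bounds go through one induction because subtraction exchanges them in its second
    argument. *)
Lemma eval_lipschitz (L : lgroupType) V (e : L) (x y : V -> L) t : 0 <= e ->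
  (forall i, x i <= y i + e /\ y i <= x i + e) ->
  eval x t <= eval y t + e *+ term_size t /\ eval y t <= eval x t + e *+ term_size t.
Proof.
move=> e0 xy.
elim: t => [i|s [s1 s2] t [t1 t2]|s [s1 s2] t [t1 t2]|s [s1 s2] t [t1 t2]] /=;
  first exact: xy.
all: rewrite mulrnDr.
- by split; rewrite addrACA; apply: lg_leD => //; rewrite -lg_leBlDr -opprD lg_leN2.
all: have es := lg_mulrn_ge0 (term_size s) e0; have et := lg_mulrn_ge0 (term_size t) e0.
all: have weak (u v w p q : L) : 0 <= q -> u <= v -> v <= w + p -> u <= w + (p + q)
  by move=> q0 uv /(le_trans uv)/le_trans; apply; rewrite addrA -[leLHS]addr0 lg_leD2l.
all: have weak' (u v w p q : L) : 0 <= p -> u <= v -> v <= w + q -> u <= w + (p + q)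
  by move=> p0 uv vw; rewrite [p + q]addrC; apply: (weak u v).
- split; rewrite -lg_leBlDr lmeetP !lg_leBlDr; apply/andP; split.
  + by apply: weak s1 => //; exact: lmeet_lel.
  + by apply: weak' t1 => //; exact: lmeet_ler.
  + by apply: weak s2 => //; exact: lmeet_lel.
  + by apply: weak' t2 => //; exact: lmeet_ler.
- split; rewrite ljoinP; apply/andP; split.
  + apply: weak (lexx _) _ => //; apply: le_trans s1 _; rewrite lg_leD2r; exact: le_ljoinl.
  + apply: weak' (lexx _) _ => //; apply: le_trans t1 _; rewrite lg_leD2r; exact: le_ljoinr.
  + apply: weak (lexx _) _ => //; apply: le_trans s2 _; rewrite lg_leD2r; exact: le_ljoinl.
  + apply: weak' (lexx _) _ => //; apply: le_trans t2 _; rewrite lg_leD2r; exact: le_ljoinr.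
Qed.

Lemma entails_embed (A B : plgroup) (f : A -> B) :
  plgroup_hom f -> (forall z, 0 <= f z -> 0 <= z) -> entails B A.
Proof.
move=> [fhom fpt] f0 t tB x x0; apply: f0; rewrite (eval_hom _ _ fhom).
by apply: tB; rewrite /= x0.
Qed.

Lemma mulz_hom (L : lgroupType) (e : L) : 0 <= e ->
  @lgroup_hom (rdom_lgroup int) L (intmul e).
Proof.
move=> e0; apply: monotone_lgroup_hom; first exact: rdom_total.
  by move=> m n; rewrite mulrzBr.
move=> m n; rewrite -subr_ge0 => mn.
by rewrite -lg_subr_ge0 -mulrzBr; exact: lg_mulz_ge0.
Qed.

Lemma entails_Zpt (A : plgroup) (e : A) (n : int) :
  0 < e -> e *~ n = plpt A -> entails A (Zpt n).
Proof.
move=> e0 en; apply: (@entails_embed (Zpt n) A (intmul e)).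
  by split=> //; exact/mulz_hom/ltW.
by move=> z; rewrite -[0 in leLHS](mulr0z e) (lg_lez e0).
Qed.

Lemma fourier_motzkin_lgroup (L : lgroupType) K (x : nat -> L) cs :
  sat K x cs -> exists y : nat -> int,
    forall c, c \in cs -> ineq c.2 (dot K y c.1).
Proof.
move=> xcs.
apply: (@fourier_motzkin L (fun z => 0 < z) (fun z => 0 <= z) _ _ _ _ K x) => //.
- by rewrite ltxx.
- by move=> z /ltW.
- by move=> y z; exact: lg_addr_ge0.
- by move=> y z y0 z0; rewrite -[0]addr0 lg_lt_leD.
- by move=> c /xcs; rewrite /ineq; case: (c.2).
Qed.

(** Vanishing of the point is a homogeneous condition, so it is added to the system as two weak
    constraints. *)
Lemma entails_Zpt0 (A : plgroup) :
  totally_ordered A -> plpt A = 0 -> entails (Zpt 0) A.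
Proof.
move=> Atot pt0; apply: entails_by_constraints => // K x cs K0 x0 xcs.
pose cs' := [:: (unit_form 0, false), (fun i => 0 - unit_form 0 i, false) & cs].
have dotN (M : zmodType) (y : nat -> M) :
    dot K y (fun i => 0 - unit_form 0 i) = - y 0%N.
  by rewrite (dotB _ _ (fun=> 0)) [dot _ _ (fun=> 0)]big1 ?sub0r ?dot_unit // => i _; rewrite mulr0z.
have [|y Hy] := @fourier_motzkin_lgroup A K x cs'.
  move=> c; rewrite !inE => /or3P[/eqP ->|/eqP ->|/xcs//] /=.
    by rewrite dot_unit // x0 pt0.
  by rewrite dotN x0 pt0 oppr0.
exists y; split; last first.
  by move=> c ccs; apply: Hy; rewrite !inE ccs !orbT.
apply: le_anti; have /= := Hy (unit_form 0, false).
rewrite inE eqxx dot_unit // => /(_ isT) ->; rewrite andbT.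
have /= := Hy (fun i => 0 - unit_form 0 i, false).
by rewrite !inE eqxx orbT dotN oppr_ge0 => /(_ isT).
Qed.

(** Positivity of the point is added as a strict constraint; dividing the integer solution by its
    value there normalizes the point to 1. *)
Lemma entails_Rpt1 (R : realType) (A : plgroup) :
  totally_ordered A -> 0 < plpt A -> entails (Rpt R 1) A.
Proof.
move=> Atot pt0; apply: entails_by_constraints => // K x cs K0 x0 xcs.
have [|y Hy] := @fourier_motzkin_lgroup A K x ((unit_form 0, true) :: cs).
  by move=> c; rewrite !inE => /predU1P[->|/xcs//]; rewrite /= dot_unit // x0.
have y0 : 0 < (y 0%N)%:~R :> R.
  have /= := Hy (unit_form 0, true).
  by rewrite inE eqxx dot_unit // ltr0z => /(_ isT).
pose w i : R := (y i)%:~R / (y 0%N)%:~R.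
have wE g : dot K w g = (dot K y g)%:~R / (y 0%N)%:~R.
  rewrite (@raddf_dot int R intr); last exact: rmorphB.
  rewrite /dot mulr_suml; apply: eq_bigr => i _.
  by rewrite -[(intr \o y) i]/((y i)%:~R) -(mulrzr (w i)) -(mulrzr (y i)%:~R) /w mulrAC.
exists w; split; first by rewrite /w divff // gt_eqF.
move=> c ccs; have : ineq c.2 (dot K y c.1) by apply: Hy; rewrite inE ccs orbT.
rewrite /ineq wE; case: (c.2).
  by rewrite pmulr_lgt0 ?invr_gt0 // ltr0z.
by rewrite pmulr_lge0 ?invr_gt0 // ler0z.
Qed.

(** Divisibility is only approximate. By [discrete_generator] its failure makes the hull of [u]
    cyclic modulo infinitesimals. *)
Definition divisible_point (L : lgroupType) (u : L) : Prop := forall N : nat,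
  exists (e : L) (M : nat), [/\ 0 < e, (N <= M)%N & e *+ M <= u <= e *+ M.+1].

Lemma entails_Rpt1_divisible (R : realType) (A : plgroup) :
  divisible_point (plpt A) -> entails A (Rpt R 1).
Proof.
move=> Adiv; apply: entails_by_refutation => [|t w w0 wt]; first exact: rdom_total.
pose C := term_size t; pose d := - eval w t : R.
have d0 : 0 < d by rewrite oppr_gt0.
(* After scaling by [M] the refuting value is [- d * M]. Rounding to integers costs up to [C], and
   replacing [e *+ M] by the point up to [C] times [e], hence the bound [C + C]. *)
have [e [M [e0 NM /andP[Ma aM]]]] := Adiv (Num.bound ((C + C)%:R / d)).
have MC : (C + C)%:R < d * M%:R.
  rewrite mulrC -ltr_pdivrMr //; apply: (@lt_le_trans _ _ _ _ _ (archi_boundP _)).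
    by rewrite divr_ge0 // ltW.
  by rewrite ler_nat.
pose z i : int := Num.floor (w i * M%:R).
have z0 : z 0%N = M by rewrite /z w0 mul1r -[M%:R]/((M%:Z)%:~R) intrKfloor.
pose T : int := eval (L := rdom_lgroup int) z t.
have TC : T + C%:Z < 0.
  have Mhom : @lgroup_hom (rdom_lgroup R) (rdom_lgroup R) ( *%R^~ M%:R).
    apply: monotone_lgroup_hom; first exact: rdom_total.
      by move=> x y; rewrite mulrBl.
    by move=> x y xy; rewrite ler_wpM2r.
  have zhom := @mulz_hom (rdom_lgroup R) 1 ler01.
  have := @eval_lipschitz (rdom_lgroup R) nat 1 (fun i => w i * M%:R)
    (fun i => (z i)%:~R) t ler01.
  case.
    move=> i; have := floor_le (w i * M%:R); have := floorD1_gt (w i * M%:R).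
    rewrite rmorphD /=; rewrite -/(z i) => h1 h2; split; first exact: ltW.
    by apply: le_trans h2 _; rewrite lerDl ler01.
  move=> _; rewrite -(eval_hom w t Mhom) -(@eval_hom (rdom_lgroup int) _ _ _ z t zhom) -/T -/C => h.
  have {}h : T%:~R <= - (d * M%:R) + C%:R :> R by rewrite /d mulNr opprK.
  rewrite -(ltr_int R) rmorphD /=; move: MC h; rewrite natrD; lra.
have zhom := @mulz_hom A e (ltW e0).
pose y i := if i == 0%N then plpt A else e *~ z i.
have [|_] := @eval_lipschitz A nat e (fun i => e *~ z i) y t (ltW e0).
  move=> i; rewrite /y; case: eqP => [->|_]; last first.
    by rewrite -{1 3}[_ *~ _]addr0 lg_leD2l ltW.
  rewrite z0 -pmulrn -mulrSr aM; split => //.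
  by apply: (le_trans Ma); rewrite -{1}[plpt A]addr0 lg_leD2l ltW.
rewrite -(@eval_hom (rdom_lgroup int) _ _ _ z t zhom) -/T -/C => h; exists y; split => //.
apply: le_lt_trans h _; rewrite pmulrn -mulrzDr.
by rewrite -[X in _ < X](mulr0z e) lg_ltz.
Qed.

(** * Convex subgroups and rank *)

Section ConvexSubgroups.
Variables (L : lgroupType) (Ltot : totally_ordered L).
Implicit Types (x y z u : L) (S : set L).

Lemma total_convex_lsubgroup S : S 0 ->
  (forall x y, S x -> S y -> S (x - y)) ->
  (forall x y z, S x -> S y -> x <= z -> z <= y -> S z) -> convex_lsubgroup S.
Proof.
move=> S0 SB Scvx; split => //; split => // x y Sx Sy.
  by case/orP: (Ltot x y) => xy; rewrite ?(lmeet_l xy) ?(lmeet_r xy).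
by case/orP: (Ltot x y) => xy; rewrite ?(ljoin_l xy) ?(ljoin_r xy).
Qed.

Section Closure.
Variables (S : set L) (Scvx : convex_lsubgroup S).

Lemma convexB x y : S x -> S y -> S (x - y).
Proof. by have [[_ SB _ _] _] := Scvx; exact: SB. Qed.

Lemma convex0 : S 0. Proof. by have [[]] := Scvx. Qed.

Lemma convexN x : S x -> S (- x).
Proof. by move=> Sx; rewrite -sub0r; apply: convexB => //; exact: convex0. Qed.

Lemma convexD x y : S x -> S y -> S (x + y).
Proof. by move=> Sx Sy; rewrite -[y]opprK; apply: convexB => //; exact: convexN. Qed.

Lemma convexMz x m : S x -> S (x *~ m).
Proof.
move=> Sx; suff Sn n : S (x *+ n).
  by case: m => n; [exact: Sn|rewrite NegzE mulrNz; exact/convexN/Sn].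
by elim: n => [|n IH]; rewrite ?mulr0n ?mulrS; [exact: convex0|exact: convexD].
Qed.

Lemma convex_dot K (x : nat -> L) g :
  (forall i, (i < K)%N -> S (x i)) -> S (dot K x g).
Proof.
move=> Sx; rewrite /dot; elim/big_ind: _ => [|y z|i _]; first exact: convex0.
  exact: convexD.
exact/convexMz/Sx.
Qed.

Lemma convex_between y z : S y -> 0 <= z -> z <= y -> S z.
Proof. by have [_ cvx] := Scvx; move=> Sy; apply: cvx => //; exact: convex0. Qed.

(** For [y >= 0] and [m != 0], [y] lies between 0 and its multiple by the absolute value of [m].
    This is the purity that [pure_basis] asks for. *)
Lemma convex_pure x m : m != 0 -> S (x *~ m) -> S x.
Proof.
move=> m0 Sxm.
have Spos y : 0 <= y -> S (y *~ m) -> S y.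
  move=> y0 Sym.
  have Sy : S (y *+ `|m|%N).
    move: m Sym {m0 Sxm} => [n|n]; first by [].
    by rewrite NegzE mulrNz => /(convexN); rewrite opprK.
  apply: (convex_between Sy) => //; rewrite -{1}[y]mulr1n.
  by apply: lg_lenr => //; rewrite absz_gt0.
case/orP: (Ltot 0 x) => x0; first exact: Spos.
rewrite -[x]opprK; apply/convexN/Spos; first by rewrite lg_oppr_ge0.
by rewrite mulNrz; exact: convexN.
Qed.

Lemma convex_lt x y : 0 <= y -> ~ S y -> S x -> x < y.
Proof.
by move=> y0 Sy Sx; rewrite lg_ltNge //; apply/negP => yx; apply/Sy/(convex_between Sx).
Qed.

End Closure.

(** Letting [k] take both signs bounds [x] from both sides. Applied to the absolute value of the
    point, this set is the p-radical and [hull] is the smallest convex subgroup containing the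
    point. *)
Definition infinitesimal u : set L := [set x | forall k : int, x *~ k < u].

Definition hull u : set L :=
  [set x | exists n : nat, - (u *+ n) <= x /\ x <= u *+ n].

Variables (u : L) (u0 : 0 < u).

Lemma infinitesimal_convex : convex_lsubgroup (infinitesimal u).
Proof.
apply: total_convex_lsubgroup => [k|x y Ix Iy k|x y z Ix Iy xz zy k].
- by rewrite mul0rz.
- have half v w : v *+ 2 < u -> w *+ 2 < u -> v + w < u.
    move=> v2 w2; case/orP: (Ltot v w) => vw.
      by apply: le_lt_trans w2; rewrite mulr2n lg_leD2r.
    by apply: le_lt_trans v2; rewrite mulr2n lg_leD2l.
  rewrite mulrzBl -mulrNz; apply: half.
    by have := Ix (k * 2); rewrite mulrzA.
  by have := Iy (- k * 2); rewrite mulrzA.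
- case: k => n.
    by apply: le_lt_trans (Iy n%:Z); exact: lg_lez2r.
  apply: le_lt_trans (Ix (Negz n)).
  by rewrite NegzE !mulrNz lg_leN2; exact: lg_lez2r.
Qed.

Lemma hull_convex : convex_lsubgroup (hull u).
Proof.
apply: total_convex_lsubgroup => [|x y [m [mx xm]] [n [ny yn]]|x y z [m [mx xm]] [n [ny yn]] xz zy].
- by exists 0%N; rewrite mulr0n oppr0.
- exists (m + n)%N; rewrite mulrnDr opprD; split; apply: lg_leD => //.
    by rewrite lg_leN2.
  by rewrite -lg_leN2 opprK.
- exists (m + n)%N; rewrite mulrnDr opprD; split.
    apply: le_trans xz; apply: le_trans mx.
    by rewrite -[leRHS]addr0 lg_leD2l -oppr0 lg_leN2 lg_mulrn_ge0 // ltW.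
  apply: (le_trans zy); apply: (le_trans yn).
  by rewrite -[leLHS]add0r lg_leD2r lg_mulrn_ge0 // ltW.
Qed.

Lemma hull_unit : hull u u.
Proof.
by exists 1%N; rewrite mulr1n lexx; split => //; apply: le_trans (ltW u0); rewrite -oppr0 lg_leN2 ltW.
Qed.

Lemma infinitesimal_unit : ~ infinitesimal u u.
Proof. by move=> /(_ 1); rewrite ltxx. Qed.

Lemma hull_smallest S : convex_lsubgroup S -> S u -> hull u `<=` S.
Proof.
move=> Scvx Su x [n [nx xn]]; have [_ cvx] := Scvx.
by apply: cvx nx xn; [apply/(convexN Scvx)|]; exact: (@convexMz S Scvx u n).
Qed.

Lemma infinitesimal_largest S :
  convex_lsubgroup S -> ~ S u -> S `<=` infinitesimal u.
Proof.
move=> Scvx Su x Sx k; apply: (convex_lt Scvx) => //; first exact: ltW.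
exact: convexMz.
Qed.

End ConvexSubgroups.

Lemma lex_total (L M : lgroupType) (Ltot : totally_ordered L) :
  totally_ordered M -> totally_ordered (lex_lgroup Ltot M).
Proof.
move=> Mtot [x x'] [y y']; rewrite !lex_leE /= [y == x]eq_sym.
by case: (lex_cmpP Ltot x y) => //= _; exact: Mtot.
Qed.

(** * Points that are multiples of a generator modulo infinitesimals *)

Section DiscretePoint.
Variables (A : plgroup) (Atot : totally_ordered A) (n : int) (c : A).
Variables (P H : set A).
Hypotheses (Pcvx : convex_lsubgroup P) (Hcvx : convex_lsubgroup H).
Hypotheses (n0 : n != 0) (c0 : 0 < c) (Pc : ~ P c) (PH : P `<=` H) (Hc : H c).
Hypothesis Hpt : H (plpt A).
Hypothesis Hmod : forall x, H x -> exists k : int, P (x - c *~ k).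
Hypothesis Ppt : P (plpt A - c *~ n).

(** By [xE] a linear form in [x] has a part outside [H], a multiple of [c] and a part in [P]; the
    first of these that does not vanish decides its sign. [w1] encodes the first two and [w2] the
    last. The clause on [P = [set 0]] lets one construction serve both models. *)
Lemma discrete_constraints K (x : nat -> A) cs :
  (0 < K)%N -> x 0%N = plpt A -> sat K x cs ->
  exists w1 w2 : nat -> int,
    [/\ w1 0%N = n, w2 0%N = 0, P = [set 0] -> forall i, w2 i = 0 &
      forall d, d \in cs ->
        0 < dot K w1 d.1 \/ dot K w1 d.1 = 0 /\ ineq d.2 (dot K w2 d.1)].
Proof.
move=> K0 x0 xcs.
have [r [b [h [Hxb bfree]]]] := @pure_basis A H (convex0 Hcvx)
  (convexB Hcvx) (convex_pure Atot Hcvx) K x.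
have /choice[ga Pga] : forall i, exists k : int,
    (i < K)%N -> P (x i - dot r b (h i) - c *~ k).
  move=> i; case: (ltnP i K) => [iK|_]; last by exists 0.
  by have [k Pk] := Hmod (Hxb i iK); exists k.
pose p i := x i - dot r b (h i) - c *~ ga i.
pose G (g : nat -> int) j := dot K (h^~ j) g.
have xE g : dot K x g = dot r b (G g) + c *~ dot K ga g + dot K p g.
  rewrite -dot_exchange -dot_single -!dotDl; apply: eq_dot => // i _.
  by rewrite /p -[x i - _ - _]addrA -opprD [RHS]addrC subrK.
have Pp g : P (dot K p g) by apply: convex_dot.
have HcP g : H (c *~ dot K ga g + dot K p g).
  by apply: convexD => //; [exact: convexMz|exact/PH/Pp].
(* The point lies in [H], so independence modulo [H] makes its outer coordinates vanish, whatever
   values are later given to [b]. *)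
have h0 j : (j < r)%N -> h 0%N j = 0.
  apply: bfree; have := convexB Hcvx Hpt (Hxb 0%N K0).
  by rewrite x0 opprB addrC subrK.
have ga0 : ga 0%N = n.
  have dot0 : dot r b (h 0%N) = 0.
    by rewrite /dot big1 // => i _; rewrite h0 // mulr0z.
  have := convexB Pcvx (Pga 0%N K0) Ppt.
  rewrite x0 dot0 subr0 opprB addrC addrA subrK -mulrzBr => Pd.
  apply/eqP; rewrite eq_sym -subr_eq0; apply/negP => /negP d0.
  by apply/Pc/(convex_pure Atot Pcvx d0).
pose zeroG (g : nat -> int) := [forall j : 'I_r, G g j == 0].
have zeroGP g : zeroG g -> dot r b (G g) = 0.
  by move=> /forallP Gg; rewrite /dot big1 // => j _; rewrite (eqP (Gg j)) mulr0z.
have [Y HY] : exists Y : nat -> int, forall d, d \in cs -> ~~ zeroG d.1 ->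
    0 < dot r Y (G d.1).
  (* Strict positivity means here lying above all of [H]: a form that is nonnegative and has its
     outer part outside [H] has that part above [H]. *)
  have [|||||Y HY] := @fourier_motzkin A (fun z => forall y, H y -> y < z)
      (fun z => 0 <= z) _ _ _ _ r b [seq (G d.1, true) | d <- cs & ~~ zeroG d.1].
  - by move=> /(_ 0 (convex0 Hcvx)); rewrite ltxx.
  - by move=> z /(_ 0 (convex0 Hcvx)) /ltW.
  - by move=> y z; exact: lg_addr_ge0.
  - by move=> y z Sy z0 v /Sy vy; rewrite -[v]addr0 lg_lt_leD.
  - move=> _ /mapP[d + ->] /=; rewrite mem_filter => /andP[Gd dcs].
    have nH : ~ H (dot r b (G d.1)).
      move=> /bfree z; move/negP: Gd; apply; apply/forallP => j.
      by rewrite z.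
    have := ineqW (xcs d dcs); rewrite xE -addrA => ge0 y Hy.
    rewrite lg_ltNge //; apply/negP => ley; apply: nH.
    have [_ cvx] := Hcvx; apply: (cvx (- (c *~ dot K ga d.1 + dot K p d.1)) y) => //.
      exact: convexN.
    by rewrite -lg_subr_ge0 opprK.
  exists Y => d dcs Gd; apply: (HY (G d.1, true)).
  by apply/mapP; exists d => //; rewrite mem_filter Gd.
have [q [Hq0 Hq]] : exists q : nat -> int, (P = [set 0] -> forall i, q i = 0) /\
    forall d, d \in cs -> zeroG d.1 -> dot K ga d.1 = 0 ->
      ineq d.2 (dot K q d.1).
  have Hp d : d \in cs -> zeroG d.1 -> dot K ga d.1 = 0 ->
      ineq d.2 (dot K p d.1).
    by move=> /xcs + Gd gad; rewrite xE zeroGP // gad mulr0z !add0r.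
  have [P0|P0] := pselect (P = [set 0]).
    exists (fun=> 0); split => // d dcs Gd gad.
    have : dot K p d.1 = 0 by have := Pp d.1; rewrite P0.
    have := Hp d dcs Gd gad; rewrite [dot K (fun=> 0) _]big1 => [|i _].
      by rewrite /ineq => + p0; case: (d.2); rewrite p0 ?ltxx.
    by rewrite mul0rz.
  have [|q Hq] := @fourier_motzkin_lgroup A K p
      [seq d <- cs | zeroG d.1 & dot K ga d.1 == 0].
    by move=> d; rewrite mem_filter => /andP[/andP[Gd /eqP gad] /Hp]; apply.
  exists q; split => // d dcs Gd gad; apply: Hq.
  by rewrite mem_filter Gd gad eqxx.
(* [N] exceeds every middle value in absolute value, so a positive outer value, being at least 1,
   dominates once multiplied by [N]. *)
pose N : int := 1 + \sum_(d <- cs) `|dot K ga d.1|.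
have N0 : 0 < N by rewrite ltr_pwDl // sumr_ge0.
have HN d : d \in cs -> - dot K ga d.1 < N.
  move=> dcs; rewrite /N (big_rem d) //= addrCA.
  apply: (le_lt_trans (ler_norm _)); rewrite normrN ltrDl.
  by rewrite ltr_pwDl // sumr_ge0.
exists (fun i => dot r Y (h i) *~ N + ga i).
(* At the point [ga] is [n], so the two summands cancel. Where the form vanishes on [ga], only
   [n * n > 0] times its value on [q] remains, so signs are preserved for [n] of either sign. *)
exists (fun i => ga i *~ (- (n * q 0%N)) + q i *~ (n * n)); split.
- rewrite ga0 /dot big1 ?mul0rz ?add0r // => i _; by rewrite h0 // mulr0z.
- by rewrite ga0 !mulrzz; ring.
- by move=> P0 i; rewrite !Hq0 // mulr0 oppr0 mulr0z mul0rz.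
move=> d dcs; rewrite !dotDl !dotMl dot_exchange -/(G d.1).
have [Gd|Gd] := boolP (zeroG d.1); last first.
  left; have Y0 := HY d dcs Gd; have := HN d dcs; rewrite mulrzz.
  set u := dot r Y _ in Y0 *; set v := dot K ga _ => vN.
  have : N <= u * N by rewrite ler_peMl // ltW.
  by move: vN; lia.
have -> : dot r Y (G d.1) = 0.
  rewrite /dot big1 // => j _; by move/forallP: Gd => /(_ j)/eqP ->; rewrite mulr0z.
rewrite mul0rz add0r.
have [gad|gad|gad] := ltgtP (dot K ga d.1) 0.
(* A negative multiple of [c] plus an infinitesimal is negative, against the constraint. *)
- exfalso; have := ineqW (xcs d dcs); rewrite xE zeroGP // add0r.
  apply/negP; rewrite -lg_ltNge //.
  have : dot K p d.1 < c by apply: (convex_lt Atot Pcvx) => //; exact: ltW.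
  rewrite -(lg_ltD2l (c *~ dot K ga d.1)) => /lt_le_trans; apply.
  rewrite -{2}[c]mulr1z -mulrzDr -[leRHS](mulr0z c) (lg_lez c0); lia.
- by left.
right; split => //; rewrite gad mul0rz add0r.
have nn : 0 < n * n by rewrite -expr2 exprn_even_gt0.
have := Hq d dcs Gd gad; rewrite /ineq mulrzz; case: (d.2).
  by move=> h1; rewrite mulr_gt0.
by move=> h1; rewrite mulr_ge0 // ltW.
Qed.

Lemma entails_Zlex : entails (Zlex n) A.
Proof.
apply: entails_by_constraints => // K x cs K0 x0 xcs.
have [w1 [w2 [w10 w20 _ Hw]]] := discrete_constraints K0 x0 xcs.
exists (fun i => (w1 i, w2 i)); split; first by rewrite w10 w20.
move=> d dcs.
have -> : dot K (fun i => (w1 i, w2 i) : Zlex n) d.1 =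
    (dot K w1 d.1, dot K w2 d.1).
  rewrite [LHS]surjective_pairing; congr (_, _).
    exact: (@raddf_dot (Zlex n) int fst).
  exact: (@raddf_dot (Zlex n) int snd).
case: (Hw d dcs) => [D1|[-> D2]].
  have : (0 : Zlex n) < (dot K w1 d.1, dot K w2 d.1).
    rewrite lt_def lex_leE /= D1 /= andbT; apply/eqP => -[e _].
    by rewrite e ltxx in D1.
  by rewrite /ineq; case: (d.2) => // /ltW.
move: D2; rewrite /ineq; case: (d.2) => D2; last by rewrite lex_leE /= D2.
rewrite lt_def lex_leE /= (ltW D2) andbT; apply/eqP => -[e].
by rewrite e ltxx in D2.
Qed.

Lemma entails_Zpt_of_discrete : P = [set 0] -> entails (Zpt n) A.
Proof.
move=> P0; apply: entails_by_constraints => // K x cs K0 x0 xcs.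
have [w1 [w2 [w10 _ w2E Hw]]] := discrete_constraints K0 x0 xcs.
exists w1; split => // d /Hw.
rewrite [dot K w2 _]big1 => [|i _]; last by rewrite w2E // mul0rz.
by rewrite /ineq; case: (d.2) => -[|[->]] // /ltW.
Qed.

Lemma discrete_entails_Zpt : P = [set 0] -> entails A (Zpt n).
Proof.
move=> P0; apply: (entails_Zpt c0).
by move: Ppt; rewrite P0 /= => /subr0_eq.
Qed.

Section Embedding.
Variables (b : A) (b0 : 0 < b) (Pb : P b) (N : nat).

(** The factor [N] widens the gap below 0: all negative elements are sent to at most [- (b *+ N)].
    If the first coordinate is negative this holds because every multiple of [b] is below [c]. *)
Let f (z : Zlex n) : A := c *~ z.1 + b *~ (z.2 * N%:Z).

Let small (k : int) : b *~ k < c.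
Proof. by apply: (convex_lt Atot Pcvx) => //; [exact: ltW|exact: convexMz]. Qed.

Let f_lt0 (z : Zlex n) : z < 0 -> f z <= - (b *+ N).
Proof.
clear n0; case: z => z1 z2.
rewrite lt_def lex_leE /= => /andP[zN0 zlt].
rewrite /f /= -lg_subr_ge0 -opprD lg_oppr_ge0 pmulrn addrC -addrA -mulrzDr.
case/orP: zlt => [z1N|/andP[/eqP z10 z2N]].
  apply: (@le_trans _ _ (c *~ z1 + c)); first by rewrite lg_leD2l; apply/ltW/small.
  by rewrite -{2}[c]mulr1z -mulrzDr -[leRHS](mulr0z c) (lg_lez c0); lia.
rewrite z10 mulr0z add0r -[leRHS](mulr0z b) (lg_lez b0).
have {}z2N : z2 < 0.
  by rewrite lt_neqAle z2N andbT; apply/eqP => z20; rewrite z10 z20 eqxx in zN0.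
by nia.
Qed.

Let f_hom : @lgroup_hom (Zlex n) A f.
Proof.
have fB : @zmod_morphism (Zlex n) A f.
  move=> x y; rewrite /f opprD addrACA -!mulrzBr; congr (_ *~ _ + _ *~ _).
  by rewrite -mulrBl.
apply: monotone_lgroup_hom => //; first by apply: lex_total; exact: rdom_total.
move=> x y xy; have [->//|neq] := eqVneq x y.
rewrite -lg_subr_ge0 -fB -lg_leN2 oppr0.
have -> : - f (y - x) = f (x - y) by rewrite !fB opprB.
apply: le_trans (f_lt0 _) _.
  rewrite lt_def -(lg_subr_ge0 (x - y)) sub0r opprB (lg_subr_ge0 x) xy andbT.
  by rewrite eq_sym subr_eq0.
by rewrite -oppr0 lg_leN2; apply/lg_mulrn_ge0/ltW.
Qed.

(** [f] misses the point of [A] by at most [b]. Correcting this changes the value of [t] by at most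
    [b *+ term_size t], less than the gap [b *+ N]. *)
Lemma lex_embedding_refutes t (w : nat -> Zlex n) :
  plpt A - c *~ n <= b -> c *~ n - plpt A <= b -> (term_size t < N)%N ->
  w 0%N = plpt (Zlex n) -> eval w t < 0 ->
  exists y : nat -> A, y 0%N = plpt A /\ eval y t < 0.
Proof.
move=> d1 d2 tN w0 wt.
pose y i := if i == 0%N then plpt A else f (w i).
exists y; split => //.
have [|_] := @eval_lipschitz A nat b (f \o w) y t (ltW b0).
  move=> i; rewrite /y; case: eqP => [->|_] /=; last first.
    by rewrite -{1 3}[f (w i)]addr0 lg_leD2l ltW.
  rewrite w0 /f /= mul0r mulr0z addr0 ![_ + b]addrC.
  by rewrite -!lg_leBlDr.
rewrite -(eval_hom w t f_hom) => /le_lt_trans; apply.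
apply: (@le_lt_trans _ _ (- (b *+ N) + b *+ term_size t)).
  by rewrite lg_leD2r; exact: f_lt0.
rewrite addrC -lg_subr_gt0 sub0r opprB lg_subr_gt0 !pmulrn (lg_ltz b0).
by rewrite ltz_nat.
Qed.

End Embedding.

Lemma discrete_entails_Zlex : P <> [set 0] -> entails A (Zlex n).
Proof.
move=> P0.
have [b' b'0 Pb'] : exists2 b, 0 < b & P b.
  apply: contra_notP P0 => noP; apply/seteqP; split => [x Px|_ ->]; last exact: convex0.
  case: (lex_cmpP Atot x 0) => // x0; exfalso; apply: noP; last by exists x.
  by exists (- x); [rewrite -oppr0 lg_ltN2|exact: convexN].
have [b [b0 Pb d1 d2]] : exists b, [/\ 0 < b, P b, plpt A - c *~ n <= b &
    c *~ n - plpt A <= b].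
  have dN : c *~ n - plpt A = - (plpt A - c *~ n) by rewrite opprB.
  rewrite dN; move: Ppt; set d := plpt A - _ => Pd.
  have [_ _ _ PU] := Pcvx.1.
  (* The absolute value of [d] covers the error at the point; [b'] keeps [b] positive when [d] is
     0. *)
  exists (b' + ljoin d (- d)); split.
  - have : 0 <= ljoin d (- d).
      by rewrite le0_ljoin // lg_oppr_ge0; exact: Atot.
    by move=> ?; rewrite -[0]addr0 lg_lt_leD.
  - by apply: convexD => //; apply: PU => //; exact: convexN.
  - by rewrite -[leLHS]add0r; apply: lg_leD; [exact: ltW|exact: le_ljoinl].
  - by rewrite -[leLHS]add0r; apply: lg_leD; [exact: ltW|exact: le_ljoinr].
apply: entails_by_refutation => [|t w w0 wt].
  by apply: lex_total; exact: rdom_total.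
exact: (lex_embedding_refutes b0 Pb d1 d2 (ltnSn _) w0 wt).
Qed.

End DiscretePoint.

Section DiscreteGenerator.
Variables (L : lgroupType) (Ltot : totally_ordered L) (u : L) (u0 : 0 < u).

(* If [u] is not arbitrarily divisible, an element [c] fitting into [u] the
   largest possible number of times is a generator modulo infinitesimals: a
   remainder that is not infinitesimal, or its complement in [c], would be at
   most [c / 2]. *)
Lemma discrete_generator : ~ divisible_point u ->
  exists c : L, [/\ 0 < c, ~ infinitesimal u c, hull u c &
    forall x, hull u x -> exists k : int, infinitesimal u (x - c *~ k)].
Proof.
move=> /existsNP[N notN].
have Icvx := infinitesimal_convex Ltot u0; have Hcvx := hull_convex Ltot u0.
pose R m := `[< exists2 e : L, 0 < e & e *+ m <= u <= e *+ m.+1 >].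
(* The witness [u] gives [M >= 1], so that [2 * M] exceeds [M] below. *)
have R1 : R 1%N.
  by apply/asboolP; exists u => //; rewrite lexx mulr2n -{1}[u]addr0 lg_leD2l ltW.
have RN m : R m -> (m <= N)%N.
  move=> /asboolP[e e0 eu]; rewrite leqNgt; apply/negP => Nm.
  by apply: notN; exists e, m; rewrite (ltnW Nm).
case: (ex_maxnP (ex_intro (fun m => is_true (R m)) _ R1) RN) => M /asboolP[c c0 /andP[Mc cM]] maxM.
have M0 : (0 < M)%N by exact: maxM.
have halves f : 0 <= f -> f *+ 2 <= c -> infinitesimal u f.
  move=> f0 f2; apply: contrapT => If.
  have [k uk] : exists k : int, u <= f *~ k.
    move/existsNP: If => [k /negP]; rewrite -lg_leNgt // => uk; by exists k.
  have fN0 : 0 < f.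
    rewrite lt_neqAle f0 andbT; apply/eqP => e; apply: If; rewrite -e.
    exact: (convex0 Icvx).
  have : exists m : nat, u < f *+ m.+1.
    exists `|k|%N; apply: (le_lt_trans uk).
    by rewrite pmulrn (lg_ltz fN0); lia.
  case/ex_minnP => m um minm.
  have fm : f *+ m <= u.
    case: m um minm => [|m] um minm; first by rewrite mulr0n ltW.
    by rewrite lg_leNgt //; apply/negP => /minm; rewrite ltnn.
  have : R m by apply/asboolP; exists f => //; rewrite fm ltW.
  (* Since [f] fits twice into [c], it fits at least [2 * M] times into [u], against the maximality
     of [M]. *)
  move=> /maxM; apply/negP; rewrite -ltnNge.
  have : f *+ (2 * M) < f *+ m.+1.
    apply: le_lt_trans um; apply: le_trans Mc.
    by rewrite mulrnA !pmulrn; exact: lg_lez2r.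
  rewrite !pmulrn (lg_ltz fN0); lia.
exists c; split => //.
- by move=> /(_ M.+1%:Z); rewrite -pmulrn => /(le_lt_trans cM); rewrite ltxx.
- apply: (convex_between Hcvx (hull_unit u0)); first exact: ltW.
  by apply: le_trans Mc; rewrite -{1}[c]mulr1n; apply: lg_lenr => //; exact: ltW.
move=> x [n [nx xn]].
have un : u *+ n <= c *+ (M.+1 * n).
  by rewrite mulrnA !pmulrn; exact: lg_lez2r.
have [k [kx xk]] : exists k : int, c *~ k <= x /\ x < c *~ (k + 1).
  apply: (@lg_floor _ Ltot c x (M.+1 * n)) => //; last exact: le_trans un.
  by apply: le_trans nx; rewrite lg_leN2.
pose r := x - c *~ k.
have r0 : 0 <= r by rewrite lg_subr_ge0.
have rc : r <= c.
  by rewrite /r lg_leBlDr -{1}[c]mulr1z -mulrzDr [1 + k]addrC ltW.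
case/orP: (Ltot (r *+ 2) c) => r2; first by exists k; exact: halves.
exists (k + 1); have -> : x - c *~ (k + 1) = - (c - r).
  by rewrite /r opprB mulrzDr mulr1z opprD addrA.
apply: (convexN Icvx); apply: halves; first by rewrite lg_subr_ge0.
by rewrite mulrnBl lg_leBlDr mulr2n lg_leD2l.
Qed.

End DiscreteGenerator.

(** Using the absolute value treats points of both signs at once: it lies in the same convex
    subgroups as the point, and it is given by a term. *)
Definition pt_abs (A : plgroup) : A := ljoin (plpt A) (- plpt A).

Lemma convex_pt_abs (A : plgroup) (S : set A) : totally_ordered A ->
  convex_lsubgroup S -> S (pt_abs A) <-> S (plpt A).
Proof.
move=> Atot Scvx; split=> [|Spt]; last first.
  by have [[_ _ _ SU] _] := Scvx; apply: SU => //; exact: convexN.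
rewrite /pt_abs; case/orP: (Atot (plpt A) (- plpt A)) => [/ljoin_r ->|/ljoin_l -> //].
by move=> /(convexN Scvx); rewrite opprK.
Qed.

Lemma pt_abs_gt0 (A : plgroup) :
  totally_ordered A -> plpt A != 0 -> 0 < pt_abs A.
Proof.
move=> Atot pt0; case: (lex_cmpP Atot (plpt A) 0) pt0 => [a0|a0|//].
  by move=> _; apply: lt_le_trans (le_ljoinr _ _); rewrite -oppr0 lg_ltN2.
by move=> _; apply: lt_le_trans (le_ljoinl _ _).
Qed.

(** The infinitesimals are not merely maximal but the largest convex subgroup avoiding the point, so
    [xget] has exactly one candidate and never returns its default. *)
Lemma pradicalE (A : plgroup) : totally_ordered A -> plpt A != 0 ->
  @pradical A = infinitesimal (pt_abs A).
Proof.
move=> Atot pt0; have u0 := pt_abs_gt0 Atot pt0.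
have Icvx := infinitesimal_convex Atot u0.
have largest (Q : set A) : convex_lsubgroup Q -> ~ Q (plpt A) ->
    Q `<=` infinitesimal (pt_abs A).
  by move=> Qcvx Qpt; apply: infinitesimal_largest => //; rewrite convex_pt_abs.
have Ipt : ~ infinitesimal (pt_abs A) (plpt A).
  by rewrite -convex_pt_abs //; exact: infinitesimal_unit.
rewrite /pradical; case: xgetP => [P _ [Pcvx Ppt Pmax]|noP].
  by rewrite -(Pmax _ Icvx Ipt (largest _ Pcvx Ppt)).
exfalso; apply: (noP (infinitesimal (pt_abs A))); split=> // Q Qcvx Qpt IQ.
by apply/seteqP; split => //; exact: largest.
Qed.

Lemma p_simpleE (A : plgroup) : totally_ordered A -> plpt A != 0 ->
  p_simple A <-> infinitesimal (pt_abs A) = [set 0].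
Proof.
by move=> Atot pt0; rewrite /p_simple pradicalE //; split=> [[]|].
Qed.

Lemma lgroup_iso_sym (L M : lgroupType) (g : L -> M) :
  lgroup_hom g -> bijective g -> lgroup_iso M L.
Proof.
move=> [gB gI gU] [f gK fK]; exists f; last by exists g.
by split=> x y; apply: (can_inj gK); rewrite ?gB ?gI ?gU !fK.
Qed.

(** * The rank in terms of elements *)

Section Rank.
Variables (A : plgroup) (Atot : totally_ordered A) (pt0 : plpt A != 0).
Let u := pt_abs A.
Let u0 : 0 < u := pt_abs_gt0 Atot pt0.
Let B := point_hull_plgroup A.
Let Q := pradical_quot B.
Let C : convexLSubgroup B := ConvexLSubgroup B (@pradical B) (@pradical_convex B).
Let pi (x : B) : Q := quot_pi C x.

Lemma point_hullE : cvx_set (point_hull A) = hull u.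
Proof.
have Hcvx := hull_convex Atot u0; apply/seteqP; split.
  apply: smallest_sub => // _ ->; apply/(convex_pt_abs Atot Hcvx).
  exact: hull_unit.
apply: hull_smallest => //; first exact: convex_lsubgroup_smallest.
apply/(convex_pt_abs Atot (convex_lsubgroup_smallest _)).
exact: sub_gen_smallest.
Qed.

Let Btot : totally_ordered B.
Proof. by move=> x y; exact: Atot. Qed.

Let ptB0 : plpt B != 0.
Proof. by rewrite -val_eqE. Qed.

Let val_ltE (x y : B) : (x < y) = (val x < val y).
Proof. by rewrite !lt_def -val_eqE. Qed.

Let valMz (x : B) (k : int) : val (x *~ k) = val x *~ k.
Proof. exact: raddfMz. Qed.

Let infB (x : B) : @pradical B x <-> infinitesimal u (val x).
Proof.
rewrite pradicalE //; split=> H k; have := H k; by rewrite val_ltE valMz.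
Qed.

Let piB : @zmod_morphism B Q pi.
Proof. exact: quot_piB. Qed.

Let piP (x y : B) : pi x = pi y <-> infinitesimal u (val x - val y).
Proof. by rewrite /pi quot_piP /= infB. Qed.

Let in_hull (x : A) : hull u x -> {y : B | val y = x}.
Proof.
move=> Hx; have Cx : cvx_pred (point_hull A) x.
  by apply/cvx_predP; rewrite point_hullE.
by exists (Sub x Cx).
Qed.

Let val_hull (x : B) : hull u (val x).
Proof. by rewrite -point_hullE; apply/cvx_predP; exact: valP. Qed.

(** Finite rank [n] without quotients: [c] lifts the generator 1 of the integers. These are the
    hypotheses on [c] in the treatment of discrete points. *)
Definition discrete_at (n : int) (c : A) : Prop :=
  [/\ 0 < c, ~ infinitesimal u c, hull u c,
      forall x, hull u x -> exists k : int, infinitesimal u (x - c *~ k) &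
      infinitesimal u (plpt A - c *~ n)].

Lemma quot_iso_discrete n : plgroup_iso Q (Zpt n) -> exists c, discrete_at n c.
Proof.
move=> [f [fhom fpt] [g fK gK]]; have [fB _ _] := fhom.
pose phi x := f (pi x).
have phiB : @zmod_morphism B int phi by move=> x y; rewrite /phi piB fB.
have phi0 : phi 0 = 0 by exact: (zmod_morphism0 phiB).
have phiP x y : phi x = phi y <-> infinitesimal u (val x - val y).
  by rewrite -piP /phi; split=> [/(can_inj fK)|->].
have [c phic] : exists c, phi c = 1.
  by exists (quot_repr (g 1)); rewrite /phi /pi quot_reprK gK.
have phiM k : phi (c *~ k) = k.
  pose phiA := GRing.isZmodMorphism.Build B int phi phiB.
  pose phiR : {additive B -> int} := HB.pack phi phiA.
  by rewrite -[phi _]/(phiR _) raddfMz /= phic -[RHS]intz.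
have phi_mono x y : x <= y -> phi x <= phi y.
  move=> xy; apply: (lgroup_hom_le fhom); exact: quot_pi_le.
exists (val c); split.
- rewrite -[0]/(val (0 : B)) -val_ltE lg_ltNge //; apply/negP => /phi_mono.
  by rewrite phi0 phic.
- move=> Ic; have : phi c = phi 0 by apply/phiP; rewrite subr0.
  by rewrite phi0 phic.
- exact: val_hull.
- move=> x /in_hull[y <-]; exists (phi y).
  by rewrite -valMz; apply/phiP; rewrite phiM.
- rewrite -raddfMz -[plpt A]/(val (plpt B)); apply/phiP.
  by rewrite phiM; exact: fpt.
Qed.

(** Used contrapositively: a quotient other than the integers makes the point divisible, which gives
    access to the real model. *)
Lemma discrete_quot_iso :
  ~ divisible_point u -> lgroup_iso Q (rdom_lgroup int).
Proof.
move=> /(discrete_generator Atot u0)[c [c0 Ic Hc Hmod]].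
have [c' c'c] := in_hull Hc.
have Icvx := infinitesimal_convex Atot u0.
have ghom : @lgroup_hom (rdom_lgroup int) Q (fun k => pi (c' *~ k)).
  apply: monotone_lgroup_hom; first exact: rdom_total.
    by move=> m n; rewrite mulrzBr piB.
  move=> m n mn; apply: quot_pi_le; rewrite -lg_subr_ge0 -mulrzBr.
  apply: lg_mulz_ge0; last by rewrite subr_ge0.
  by apply: ltW; rewrite val_ltE c'c.
apply: (lgroup_iso_sym ghom).
have gsurj X : exists k : int, pi (c' *~ k) = X.
  have [k Ik] := Hmod _ (val_hull (quot_repr X)); exists k.
  rewrite -[RHS](quot_reprK X); apply/esym/piP.
  by rewrite valMz c'c.
have [f fK] := choice gsurj.
exists f => // k; apply/eqP; rewrite -subr_eq0; apply/negP => /negP d0.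
apply/Ic/(convex_pure Atot Icvx d0).
by rewrite mulrzBr -c'c -!valMz; apply/piP; rewrite fK.
Qed.

End Rank.

Lemma rank_fin_pt_neq0 (A : plgroup) (n : int) :
  n != 0 -> rank A = n%:E%E -> plpt A != 0.
Proof. by move=> n0; rewrite /rank; case: eqP => // _ [e]; rewrite e eqxx in n0. Qed.

Lemma rank_fin_discrete (A : plgroup) (n : int) : totally_ordered A ->
  plpt A != 0 -> rank A = n%:E%E -> exists c, @discrete_at A n c.
Proof.
move=> Atot pt0; rewrite /rank (negbTE pt0); case: asboolP; last by case: ifP.
move=> [f fhom fbij] [e]; apply: quot_iso_discrete => //; rewrite -e.
set S := [set n | _ ]; apply: (@xgetPex _ 0 S).
(* Any isomorphism with the integers is pointed at the image of the point, so [xget] does not fall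
   back on 0. *)
exists (f (plpt (pradical_quot (point_hull_plgroup A)))).
by exists f => //; split.
Qed.

Lemma rank_fin_neq0 (A : plgroup) (n : int) : totally_ordered A ->
  plpt A != 0 -> rank A = n%:E%E -> n != 0.
Proof.
move=> Atot pt0 /(rank_fin_discrete Atot pt0)[c [_ _ _ _]]; apply: contraPneq => ->.
rewrite mulr0z subr0 -convex_pt_abs //; last exact/infinitesimal_convex/pt_abs_gt0.
exact: infinitesimal_unit.
Qed.

(** * Distinguishing the models *)

Fixpoint flip_pt (t : tm nat) : tm nat :=
  match t with
  | TVar i => if i is 0%N then TSub (TSub (TVar 0%N) (TVar 0%N)) (TVar 0%N)
              else TVar i
  | TSub s t => TSub (flip_pt s) (flip_pt t)
  | TMeet s t => TMeet (flip_pt s) (flip_pt t)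
  | TJoin s t => TJoin (flip_pt s) (flip_pt t)
  end.

Lemma eval_flip_pt (L : lgroupType) (x : nat -> L) t :
  eval x (flip_pt t) = eval (fun i => if i is 0%N then - x 0%N else x i) t.
Proof.
elim: t => [[|i]|s IHs t IHt|s IHs t IHt|s IHs t IHt] //=; rewrite ?IHs ?IHt //.
by rewrite subrr sub0r.
Qed.

Definition neg_pt (A : plgroup) : plgroup := PLGroup A (- plpt A).

(** Replacing variable [0] by its negative turns inequalities for one point into inequalities for
    the opposite one, so negative points reduce to positive ones. *)
Lemma entails_neg_pt (A B : plgroup) :
  entails B A -> entails (neg_pt B) (neg_pt A).
Proof.
move=> BA t tB x x0.
have := BA (flip_pt t) _ (fun i => if i is 0%N then plpt A else x i) erefl.
rewrite eval_flip_pt => H.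
have -> : x = fun i => if i is 0%N then - plpt A else if i is 0%N then plpt A else x i.
  by apply: funext => -[|i].
apply: H => y y0; rewrite eval_flip_pt; apply: tB.
by rewrite /= y0.
Qed.

Definition same_theory (A B : plgroup) := entails A B /\ entails B A.

Lemma same_theory_sym A B : same_theory A B -> same_theory B A. Proof. by case. Qed.

Lemma same_theory_trans A B C : same_theory A B -> same_theory B C -> same_theory A C.
Proof.
by move=> [AB BA] [BC CB]; split; [exact: entails_trans BC|exact: entails_trans BA].
Qed.

Lemma entails_pt_ge0 (A B : plgroup) :
  entails A B -> 0 <= plpt A -> 0 <= plpt B.
Proof.
move=> AB a0; have := AB (TVar 0%N) _ (fun=> plpt B) erefl; apply.
by move=> x /= ->.
Qed.

Lemma entails_pt_le0 (A B : plgroup) :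
  entails A B -> plpt A <= 0 -> plpt B <= 0.
Proof.
rewrite -!lg_oppr_ge0 => AB.
exact: (@entails_pt_ge0 (neg_pt A) (neg_pt B) (entails_neg_pt AB)).
Qed.

Fixpoint tmuln (k : nat) (i : nat) : tm nat :=
  if k is k'.+1 then TSub (tmuln k' i) (TSub (TSub (TVar i) (TVar i)) (TVar i))
  else TSub (TVar i) (TVar i).

Lemma eval_tmuln (L : lgroupType) (x : nat -> L) k i :
  eval x (tmuln k i) = x i *+ k.
Proof. by elim: k => [|k IH] /=; rewrite ?IH subrr ?mulr0n // sub0r opprK mulrSr. Qed.

Definition tpt_abs : tm nat :=
  TJoin (TVar 0%N) (TSub (TSub (TVar 0%N) (TVar 0%N)) (TVar 0%N)).

Lemma eval_tpt_abs (A : plgroup) (x : nat -> A) :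
  x 0%N = plpt A -> eval x tpt_abs = pt_abs A.
Proof. by move=> /= ->; rewrite subrr sub0r. Qed.

(* The varieties are told apart by two families of identities, written here as
   the disjunctions they amount to over a total order: [no_small k] forbids
   positive elements below [pt_abs / k], and [gap k m] forbids elements strictly
   between [pt_abs / m] and [pt_abs / (k + 1)]. *)
Definition no_small (k : nat) (A : plgroup) : Prop :=
  forall x : A, x <= 0 \/ pt_abs A <= x *+ k.

Definition gap (k m : nat) (A : plgroup) : Prop :=
  forall x : A, pt_abs A <= x *+ k.+1 \/ x *+ m <= pt_abs A.

Lemma valid_join (A : plgroup) (s t : tm nat) : totally_ordered A ->
  valid A (TJoin s t) <->
  forall x : nat -> A, x 0%N = plpt A -> 0 <= eval x s \/ 0 <= eval x t.
Proof.
move=> Atot; split=> H x /H /=; first by rewrite le0_ljoin // => /orP.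
by rewrite le0_ljoin // => /orP.
Qed.

Lemma entails_no_small k (A B : plgroup) :
  totally_ordered A -> totally_ordered B ->
  entails A B -> no_small k A -> no_small k B.
Proof.
move=> Atot Btot AB Ak x.
pose t := TJoin (TSub (TSub (TVar 1%N) (TVar 1%N)) (TVar 1%N)) (TSub (tmuln k 1) tpt_abs).
have /AB/(valid_join _ _ Btot) : valid A t.
  apply/valid_join => // y y0; rewrite /eval -/eval eval_tmuln eval_tpt_abs //.
  rewrite subrr sub0r lg_oppr_ge0 lg_subr_ge0.
  exact: Ak.
move=> /(_ (fun i => if i is 0%N then plpt B else x) erefl).
rewrite /eval -/eval eval_tmuln eval_tpt_abs //.
by rewrite subrr sub0r lg_oppr_ge0 lg_subr_ge0.
Qed.

Lemma entails_gap k m (A B : plgroup) :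
  totally_ordered A -> totally_ordered B ->
  entails A B -> gap k m A -> gap k m B.
Proof.
move=> Atot Btot AB Ak x.
pose t := TJoin (TSub (tmuln k.+1 1) tpt_abs) (TSub tpt_abs (tmuln m 1)).
have /AB/(valid_join _ _ Btot) : valid A t.
  apply/valid_join => // y y0.
  rewrite /eval -/eval !eval_tmuln !eval_tpt_abs // !lg_subr_ge0.
  exact: Ak.
move=> /(_ (fun i => if i is 0%N then plpt B else x) erefl).
by rewrite /eval -/eval !eval_tmuln !eval_tpt_abs // !lg_subr_ge0.
Qed.

Lemma pt_abs_Zpt n : pt_abs (Zpt n) = `|n|%N%:Z.
Proof. by rewrite /pt_abs /=; lia. Qed.

Lemma pt_abs_Zlex n : pt_abs (Zlex n) = (`|n|%N%:Z, 0).
Proof.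
rewrite /pt_abs /= /lex_join /= -[- (n, 0)]/(- n, 0).
by case: ltgtP => h; congr (_, _); lia.
Qed.

Lemma no_small_Zpt k n : n != 0 -> no_small k (Zpt n) <-> (`|n| <= k)%N.
Proof.
move=> n0; rewrite /no_small pt_abs_Zpt; split=> [/(_ 1)[//|]|nk x].
  by rewrite natz lez_nat.
have [x0|x0] := lerP x 0; [by left|right].
rewrite /= -mulr_natr natz; nia.
Qed.

Lemma no_small_Zlex k n : n != 0 -> ~ no_small k (Zlex n).
Proof.
move=> n0 /(_ (0, 1)); rewrite pt_abs_Zlex.
have -> : ((0, 1) : Zlex n) *+ k = (0, k%:Z).
  elim: k => // k IH; rewrite mulrS IH.
  by rewrite -[LHS]/(0 + 0, 1 + k%:Z) addr0 intS.
by rewrite !lex_leE /= => -[]; lia.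
Qed.

(** As [k + 1] exceeds the absolute value of [n], the first coordinate decides strictly and
    infinitesimals have no say. *)
Lemma gap_Zlex k m n : n != 0 -> (`|n| <= k)%N -> gap k m (Zlex n).
Proof.
move=> n0 nk [p j]; rewrite pt_abs_Zlex.
have fst_mul l : (((p, j) : Zlex n) *+ l).1 = p *+ l.
  by elim: l => // l IH; rewrite !mulrS -IH.
rewrite !lex_leE !fst_mul /=; have [p0|p0] := ltrP 0 p; [left|right];
  apply/orP; left; rewrite -mulr_natr natz; nia.
Qed.

(** The second coordinate [-1] handles [k + 1] equal to the absolute value of [n], where
    [(1, -1) *+ k.+1] falls short of the point by an infinitesimal only. *)
Lemma not_gap_Zlex k n : (k < `|n|)%N -> ~ gap k `|n|.+1 (Zlex n).
Proof.
move=> kn /(_ (1, -1)); rewrite pt_abs_Zlex.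
have mulE l : ((1, -1) : Zlex n) *+ l = (l%:Z, - l%:Z).
  elim: l => // l IH; rewrite mulrS IH.
  by rewrite -[LHS]/(1 + l%:Z, -1 - l%:Z) intS opprD.
by rewrite !mulE !lex_leE /= => -[]; lia.
Qed.

Section RealPoint.
Variables (R : realType) (s : R) (s1 : `|s| = 1).

Lemma pt_abs_Rpt : pt_abs (Rpt R s) = 1.
Proof.
rewrite -[LHS]/(Num.max s (- s)); have [s0|s0] := lerP 0 s.
  by move: s1; rewrite ger0_norm // => e; rewrite max_l e //; lra.
by move: s1; rewrite ltr0_norm // => e; rewrite max_r e //; lra.
Qed.

Lemma no_small_Rpt k : ~ no_small k (Rpt R s).
Proof.
have k0 : 0 < k.+1%:R :> R by rewrite ltr0n.
move=> /(_ k.+1%:R^-1); rewrite pt_abs_Rpt /= => -[].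
  by rewrite leNgt invr_gt0 k0.
move=> h; have : 1 <= k.+1%:R^-1 *+ k :> R by [].
by rewrite -[X in _ <= X]mulr_natl ler_pdivlMr // mul1r ler_nat ltnn.
Qed.

Lemma not_gap_Rpt k : ~ gap k k.+2 (Rpt R s).
Proof.
have k0 : 0 <= k%:R :> R by rewrite ler0n.
have d0 : 0 < 2 * k%:R + 3 :> R by lra.
(* The inverse of [k + 3/2], strictly between those of [k + 2] and [k + 1]. *)
move=> /(_ (2 / (2 * k%:R + 3))); rewrite pt_abs_Rpt => -[h|h].
  have : 1 <= (2 / (2 * k%:R + 3)) *+ k.+1 :> R by [].
  by rewrite -[X in _ <= X]mulr_natl mulrA ler_pdivlMr // -(natr1 k); lra.
have : (2 / (2 * k%:R + 3)) *+ k.+2 <= 1 :> R by [].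
by rewrite -[X in X <= _]mulr_natl mulrA ler_pdivrMr // -(natr1 k.+1) -(natr1 k); lra.
Qed.

End RealPoint.

(** * Classification by canonical models *)

Inductive canonical := CZ of int | CZlex of int | CR of bool.

Definition model (R : realType) (d : canonical) : plgroup :=
  match d with
  | CZ n => Zpt n
  | CZlex n => Zlex n
  | CR b => Rpt R (if b then 1 else -1)
  end.

Definition proper (d : canonical) : bool :=
  match d with CZ n | CZlex n => n != 0 | CR _ => true end.

Definition positive (d : canonical) : bool :=
  match d with CZ n | CZlex n => 0 <= n | CR b => b end.

Definition describes (d : canonical) (A : plgroup) : Prop :=
  match d with
  | CZ n => p_simple A /\ rank A = (n%:E)%E
  | CZlex n => ~ p_simple A /\ rank A = (n%:E)%E
  | CR b => rank A = (if b then +oo else -oo)%E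
  end.

Section Classification.
Variable R : realType.
Implicit Types d e : canonical.

Lemma model_total d : totally_ordered (model R d).
Proof.
case: d => [n|n|b] /=; [exact: rdom_total| |exact: rdom_total].
by apply: lex_total; exact: rdom_total.
Qed.

Lemma positiveE d : (0 <= plpt (model R d)) = positive d.
Proof.
case: d => [n|n|[]] //=; last 2 first.
- exact: ler01.
- by apply/negbTE; rewrite -ltNge ltrN10.
by rewrite lex_leE /=; lia.
Qed.

Lemma model_pt_neq0 d : proper d -> plpt (model R d) != 0.
Proof.
case: d => [n|n|[]] //= h; last 2 first.
- exact: oner_neq0.
- by rewrite oppr_eq0 oner_neq0.
by apply: contra h => /eqP[->].
Qed.

Lemma same_theory_positive d e : same_theory (model R d) (model R e) -> positive d = positive e.
Proof.
move=> [/entails_pt_ge0 de /entails_pt_ge0 ed].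
by apply/idP/idP; rewrite -!positiveE.
Qed.

Lemma norm_CR (b : bool) : `|if b then 1 else -1 : R| = 1.
Proof. by case: b; rewrite ?normrN normr1. Qed.

Let no_small_model k d e : same_theory (model R d) (model R e) ->
  no_small k (model R d) -> no_small k (model R e).
Proof. by move=> [de _]; apply: entails_no_small de; exact: model_total. Qed.

Let gap_model k m d e : same_theory (model R d) (model R e) ->
  gap k m (model R d) -> gap k m (model R e).
Proof. by move=> [de _]; apply: entails_gap de; exact: model_total. Qed.

(** [no_small] at the absolute value of [n] carries over to the other model; infinitesimals and real
    fractions both violate it. Used in both directions it gives equal absolute values, and the sign
    of the point does the rest. *)
Lemma CZ_same_theory n d : proper (CZ n) -> proper d ->
  same_theory (model R (CZ n)) (model R d) -> exists2 m, d = CZ m & (`|m| <= `|n|)%N.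
Proof.
move=> n0 d0 nd; have : no_small `|n| (model R d).
  by apply: (no_small_model nd); apply/no_small_Zpt.
case: d d0 nd => [m|m|b] d0 nd.
- by move=> /no_small_Zpt -/(_ d0); exists m.
- by move=> /no_small_Zlex -/(_ d0).
- by move=> /(no_small_Rpt (norm_CR b)).
Qed.

(** All gaps at the absolute value of [n] carry over. The alternative [CZ m] survives here and is
    excluded by [CZ_same_theory] read in the other direction. *)
Lemma CZlex_same_theory n d : proper (CZlex n) -> proper d ->
  same_theory (model R (CZlex n)) (model R d) ->
  (exists m, d = CZ m) \/ exists2 m, d = CZlex m & (`|m| <= `|n|)%N.
Proof.
move=> n0 d0 nd.
have gapd m : gap `|n| m (model R d).
  by apply: (gap_model nd); exact: gap_Zlex.
case: d d0 nd gapd => [m|m|b] d0 nd gapd; first by left; exists m.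
  right; exists m => //; rewrite leqNgt; apply/negP => /not_gap_Zlex; apply.
  exact: gapd.
by have := gapd `|n|.+2; move=> /(not_gap_Rpt (norm_CR b)).
Qed.

Lemma model_inj d e : proper d -> proper e ->
  same_theory (model R d) (model R e) -> d = e.
Proof.
move=> d0 e0 de; have ed := same_theory_sym de; have := same_theory_positive de.
case: d d0 de ed => [n|n|b] d0 de ed.
- have [m em mn] := CZ_same_theory d0 e0 de; rewrite em in e0 ed *.
  have [_ [<-] nm] := CZ_same_theory e0 d0 ed.
  by rewrite /= => nmpos; congr CZ; lia.
- have [[m em]|[m em mn]] := CZlex_same_theory d0 e0 de; rewrite em in e0 ed *.
    by have [] := CZ_same_theory e0 d0 ed.
  have [[//]|[_ [<-] nm]] := CZlex_same_theory e0 d0 ed.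
  by rewrite /= => nmpos; congr CZlex; lia.
- case: e e0 de ed => [m|m|c] e0 de ed.
  + by have [] := CZ_same_theory e0 d0 ed.
  + by have [[]|[]] := CZlex_same_theory e0 d0 ed.
  + by move=> /= ->.
Qed.

Variables (A : plgroup) (Atot : totally_ordered A).

Lemma rank_fin_same_theory n : n != 0 -> rank A = (n%:E)%E ->
  (p_simple A -> same_theory A (Zpt n)) /\ (~ p_simple A -> same_theory A (Zlex n)).
Proof.
move=> n0 rn; have pt0 := rank_fin_pt_neq0 n0 rn.
have [c [c0 Ic Hc Hmod Ipt]] := rank_fin_discrete Atot pt0 rn.
have u0 := pt_abs_gt0 Atot pt0.
have Icvx := infinitesimal_convex Atot u0; have Hcvx := hull_convex Atot u0.
have IH : infinitesimal (pt_abs A) `<=` hull (pt_abs A).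
  move=> x Ix; exists 1%N; rewrite mulr1n; split.
    by rewrite -lg_leN2 opprK -[- x]mulr1z mulNrz -mulrNz ltW.
  by rewrite -[x]mulr1z ltW.
have Hpt : hull (pt_abs A) (plpt A).
  by apply/(convex_pt_abs Atot Hcvx); exact: hull_unit.
split=> simp.
  have I0 := (p_simpleE Atot pt0).1 simp.
  split; first exact: discrete_entails_Zpt c0 Ipt I0.
  exact: (entails_Zpt_of_discrete Atot Icvx Hcvx n0 c0 Ic IH Hc Hpt Hmod Ipt I0).
have I0 : infinitesimal (pt_abs A) <> [set 0] by move=> /(p_simpleE Atot pt0).2/simp.
split; first exact: (discrete_entails_Zlex Atot Icvx c0 Ic Ipt I0).
exact: (entails_Zlex Atot Icvx Hcvx n0 c0 Ic IH Hc Hpt Hmod Ipt).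
Qed.

Lemma rank_pinfty_same_theory : rank A = +oo%E -> same_theory A (Rpt R 1).
Proof.
rewrite /rank; case: eqP => // /eqP pt0; case: asboolP => // niso; case: ifP => // a0 _.
have ptE : pt_abs A = plpt A.
  by apply: ljoin_l; apply: le_trans (ltW a0); rewrite -oppr0 lg_leN2 ltW.
split; last exact: entails_Rpt1.
apply: entails_Rpt1_divisible; rewrite -ptE; apply: contrapT.
by move=> /(discrete_quot_iso Atot pt0)/niso.
Qed.

(** [neg_pt A] has a positive point with the same absolute value, so divisibility is read off from
    [A] and the rank of [neg_pt A] is never computed. *)
Lemma rank_ninfty_same_theory : rank A = -oo%E -> same_theory A (Rpt R (-1)).
Proof.
rewrite /rank; case: eqP => // /eqP pt0; case: asboolP => // niso; case: ifP => // /negbT.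
rewrite -lg_leNgt // => a0 _.
have ptE : pt_abs A = - plpt A.
  by apply: ljoin_r; apply: (le_trans a0); rewrite lg_oppr_ge0.
have aN0 : 0 < plpt (neg_pt A) by rewrite /= -ptE pt_abs_gt0.
suff [NR RN] : same_theory (neg_pt A) (Rpt R 1).
  have negK : neg_pt (neg_pt A) = A by case: (A) => L p; rewrite /neg_pt /= opprK.
  by rewrite -negK; split; [exact: (entails_neg_pt NR)|exact: (entails_neg_pt RN)].
split; last exact: entails_Rpt1.
apply: entails_Rpt1_divisible; rewrite /= -ptE; apply: contrapT.
by move=> /(discrete_quot_iso Atot pt0)/niso.
Qed.

Lemma describes_same_theory d :
  proper d -> describes d A -> same_theory A (model R d).
Proof.
case: d => [n|n|[]] /=.
- by move=> n0 [simp rn]; have [+ _] := rank_fin_same_theory n0 rn; apply.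
- by move=> n0 [simp rn]; have [_ +] := rank_fin_same_theory n0 rn; apply.
- by move=> _; exact: rank_pinfty_same_theory.
- by move=> _; exact: rank_ninfty_same_theory.
Qed.

Lemma described : plpt A != 0 -> exists2 d, proper d & describes d A.
Proof.
move=> pt0; case e : (rank A) => [n| |]; last 2 first.
- by exists (CR true).
- by exists (CR false).
have n0 := rank_fin_neq0 Atot pt0 e.
have [simp|simp] := pselect (p_simple A); first by exists (CZ n).
by exists (CZlex n).
Qed.

(** The forward direction is formal: some [e] describes [A], so the models of [d] and [e] have the
    same theory, and [model_inj] gives [d = e]. *)
Lemma same_theory_model d : proper d ->
  same_theory A (model R d) <-> describes d A.
Proof.
move=> d0; split=> [Ad|]; last exact: describes_same_theory.
have pt0 : plpt A != 0.
  (* Entailment preserves both weak signs of the point, so a point 0 in [A] would force a point 0 in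
     the model. *)
  apply: contra (model_pt_neq0 d0) => /eqP a0; apply/eqP/le_anti.
  have [Ad' _] := Ad.
  by rewrite (entails_pt_le0 Ad') ?(entails_pt_ge0 Ad') ?a0.
have [e e0 Ae] := described pt0.
suff -> : d = e by [].
apply: model_inj => //; apply: same_theory_trans (describes_same_theory e0 Ae).
exact: same_theory_sym.
Qed.

End Classification.

(** The trivial group also has point 0 but generates only the trivial variety; a nonzero element
    provides a copy of the integers inside [A]. *)
Lemma same_theory_Zpt0 (A : plgroup) : totally_ordered A ->
  (exists x : A, x != 0) -> plpt A = 0 -> same_theory A (Zpt 0).
Proof.
move=> Atot [x x0] pt0; split; last exact: entails_Zpt0.
have [e e0] : exists e : A, 0 < e.
  case: (lex_cmpP Atot x 0) x0 => [x0|x0|//] _; last by exists x.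
  by exists (- x); rewrite -oppr0 lg_ltN2.
by apply: (entails_Zpt e0); rewrite mulr0z.
Qed.

Theorem theorem4p10 (R : realType) (A : plgroup) (n : int)
    (A_total : totally_ordered A) (A_fg : finitely_generated A)
    (n_neq0 : n != 0) :
  [/\ (exists x : A, x != 0) ->
        (same_class (HSP1 A) (HSP1 (Zpt 0)) /\
         same_class (HSP1 (Zpt 0)) (HSP1 (Rpt R 0)) <->
         plpt A = 0),
      same_class (HSP1 A) (HSP1 (Zpt n)) <->
        p_simple A /\ rank A = (n%:E)%E,
      same_class (HSP1 A) (HSP1 (Zlex n)) <->
        ~ p_simple A /\ rank A = (n%:E)%E,
      same_class (HSP1 A) (HSP1 (Rpt R 1)) <-> rank A = (+oo)%E
    & same_class (HSP1 A) (HSP1 (Rpt R (-1))) <-> rank A = (-oo)%E].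
Proof.
split; last 4 first.
- by rewrite same_HSP1P; exact: (@same_theory_model R A A_total (CZ n)).
- by rewrite same_HSP1P; exact: (@same_theory_model R A A_total (CZlex n)).
- by rewrite same_HSP1P; exact: (@same_theory_model R A A_total (CR true)).
- by rewrite same_HSP1P; exact: (@same_theory_model R A A_total (CR false)).
move=> Anontriv; split=> [[/same_HSP1P[_ ZA] _]|pt0].
  by apply/le_anti; rewrite (entails_pt_le0 ZA) ?(entails_pt_ge0 ZA).
split; apply/same_HSP1P; first exact: same_theory_Zpt0.
(* The reals pointed at 0 are another nontrivial totally ordered group to which the same lemma
   applies. *)
apply/same_theory_sym/same_theory_Zpt0 => //; first exact: rdom_total.
by exists 1; exact: oner_neq0.
Qed.
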